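(* Let $n\ge 1$ and $w\in S_n$. The map $\mathrm{chain}_{\mathrm{BPD}}$ is a bijection from $\mathrm{BPD}(w)$ to the set of chains from $w$ to $w_0$ that are compatible with $(n-1,n-2,\dots,1)$. Moreover, if $\mathrm{chain}_{\mathrm{BPD}}(D)=C$, then $\mathrm{wt}(C)$ is the reverse of the sequence $(n-1,n-2,\dots,1)-\mathrm{wt}(D)$.
   Context: Permutations are written in one-line notation; $w_0=[n,n-1,\dots,1]$; $[m]=\{1,\dots,m\}$. For $i<j$, $t_{i,j}$ is the transposition of $i,j$, and $wt_{i,j}$ is $w$ with the entries in positions $i$ and $j$ exchanged. $\ell(w)$ is the number of inversions of $w$. Bruhat covers: $u\lessdot w$ iff $w=ut_{i,j}$ for some $i<j$ and $\ell(w)=\ell(u)+1$. For $k\in[n-1]$, $u\lessdot_k w$ iff $u\lessdot w$ and $w=ut_{i,j}$ with $i\le k<j$. A $k$-chain $v_1\lessdot_k v_2\lessdot_k\cdots\lessdot_k v_d$ ($d\ge 1$; $d=1$ allowed) is increasing if, writing $v_{s+1}=v_st_{i_s,j_s}$, the smaller of the two values exchanged at step $s$ strictly increases with $s$. A sequence $(w_1,\dots,w_d)$ of permutations is compatible with $(k_1,\dots,k_{d-1})$ if for each $s\in[d-1]$ there is an increasing $k_s$-chain from $w_s$ to $w_{s+1}$; it is then a chain from $w_1$ to $w_d$, and its weight is $\mathrm{wt}(w_1,\dots,w_d)=(\ell(w_2)-\ell(w_1),\dots,\ell(w_d)-\ell(w_{d-1}))$. For $k\in\{0,\dots,n-1\}$,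 $S_n^{k\searrow}=\{u\in S_n: u(k+1)>u(k+2)>\dots>u(n)\}$. Bumpless pipe dreams: cells are indexed by matrix coordinates (row 1 on top, column 1 on the left). Tiles are of six types: blank, cross (a horizontal and a vertical pipe crossing), horizontal segment, vertical segment, an elbow joining the right edge and the bottom edge, and an elbow joining the top edge and the left edge. A $k$-row BPD ($0\le k\le n$) is a filling of a $k\times n$ grid by these tiles such that pipe segments match across shared edges, no pipe crosses the left boundary or top boundary of the grid, each of the $k$ cells in column $n$ has a pipe entering through its right edge, and any two pipes cross at most once. Then the $k$ pipes exit through the bottom edge of row $k$ in distinct columns; the $k$-row BPD is associated with the unique $u\in S_n^{k\searrow}$ such that, for $i\in[k]$, $u(i)$ is the column where the pipe entering row $i$ exits the bottom of row $k$. A bumpless pipe dream (BPD) for $w\in S_n$ is an $n$-row BPD associated with $w$ (so every column has a pipe exiting the bottom of row $n$); $\mathrm{BPD}(w)$ is the set of these. The weight $\mathrm{wt}(D)$ of a BPD $D$ is the sequence of length $n-1$ whose $i$-th entry is the number of blank tiles in row $i$. For $D\in\mathrm{BPD}(w)$ and $k=0,\dots,n-1$, let $u_k$ be the permutation associated with the $k$-row BPD formed by the first $k$ rows of $D$. Define $\mathrm{chain}_{\mathrm{BPD}}(D)=(u_{n-1},u_{n-2},\dots,u_0)$. *)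

(* Defs.v *)
(* Permutations of [n] are 'S_n = {perm 'I_n}; positions and
   values are 0-indexed (position p here = position p+1 in the paper, value
   v here = value v+1 in the paper).  Rows/columns of grids are 0-indexed too. *)
From HB Require Import structures.
From mathcomp Require Import all_boot all_order all_algebra all_fingroup.
Set Implicit Arguments. Unset Strict Implicit. Unset Printing Implicit Defensive.

Local Open Scope nat_scope.

Definition len n (u : 'S_n) : nat :=
  #|[set p : 'I_n * 'I_n | (p.1 < p.2) && (u p.2 < u p.1)]|.

Definition w0 n : 'S_n := perm (@rev_ord_inj n).

(* u <._k v via the transposition of positions i<j (0-indexed), i.e. in the
   paper's 1-indexed positions i+1 <= k < j+1.  v = u t_{i,j}: entries of u
   in positions i and j exchanged. *)
Definition kcover n (k : nat) (u v : 'S_n) (i j : 'I_n) : Prop :=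
  [/\ i < j, i < k <= j, (forall x, v x = u (tperm i j x)) & len v = (len u).+1].

Definition inc_kchain n (k : nat) (u v : 'S_n) : Prop :=
  exists (d : nat) (vs : nat -> 'S_n) (ii jj : nat -> 'I_n),
    [/\ vs 0 = u, vs d = v,
        (forall s, s < d -> kcover k (vs s) (vs s.+1) (ii s) (jj s)) &
        (forall s, s.+1 < d ->
           minn (vs s (ii s)) (vs s (jj s)) <
           minn (vs s.+1 (ii s.+1)) (vs s.+1 (jj s.+1)))].

Definition compatible n (C : seq 'S_n) (ks : seq nat) : Prop :=
  size C = (size ks).+1 /\
  forall s, s < size ks -> inc_kchain (nth 0 ks s) (nth 1%g C s) (nth 1%g C s.+1).

Definition chain_from_to n (C : seq 'S_n) (ks : seq nat) (u v : 'S_n) : Prop :=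
  [/\ compatible C ks, nth 1%g C 0 = u & last 1%g C = v].

Definition wt_chain n (C : seq 'S_n) : seq int :=
  [seq ((len (nth 1%g C s.+1))%:Z - (len (nth 1%g C s))%:Z)%R | s <- iota 0 (size C).-1].

Definition down_seq (n : nat) : seq nat := [seq n.-1 - s | s <- iota 0 n.-1].

Inductive tile :=
  | Blank
  | Cross
  | Horiz
  | Vert
  | ElbowRB
  | ElbowTL.

Definition tile2nat (t : tile) : nat :=
  match t with Blank => 0 | Cross => 1 | Horiz => 2 | Vert => 3
             | ElbowRB => 4 | ElbowTL => 5 end.
Definition nat2tile (m : nat) : option tile :=
  match m with 0 => Some Blank | 1 => Some Cross | 2 => Some Horiz
             | 3 => Some Vert | 4 => Some ElbowRB | 5 => Some ElbowTL
             | _ => None end.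
Lemma tile2natK : pcancel tile2nat nat2tile. Proof. by case. Qed.
HB.instance Definition _ := Countable.copy tile (pcan_type tile2natK).

Definition hasL t := match t with Cross | Horiz | ElbowTL => true | _ => false end.
Definition hasR t := match t with Cross | Horiz | ElbowRB => true | _ => false end.
Definition hasT t := match t with Cross | Vert | ElbowTL => true | _ => false end.
Definition hasB t := match t with Cross | Vert | ElbowRB => true | _ => false end.

(* an n x n filling by tiles; cell (r, c) = row r, column c (0-indexed,
   row 0 on top, column 0 on the left) *)
Definition grid n := {ffun 'I_n * 'I_n -> tile}.

(* access by natural-number coordinates (Blank outside the grid) *)
Definition tileAt n (D : grid n) (r c : nat) : tile :=
  match insub r, insub c with
  | Some r', Some c' => D (r', c')
  | _, _ => Blank
  end.

(* Follow a pipe inside the first k rows.  It is at cell (r, c), having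
   entered through the top edge (top = true) or the right edge (top = false).
   Returns the list of visited cells (r, c, h) with h = true iff the pipe
   traverses that cell entering from the right, and Some c' if the pipe
   leaves through the bottom edge of row k-1 (the k-th row) in column c',
   None if it gets stuck / leaves the grid otherwise. *)
Fixpoint walk (T : nat -> nat -> tile) (k fuel r c : nat) (top : bool)
  : seq (nat * nat * bool) * option nat :=
  match fuel with
  | 0 => ([::], None)
  | f.+1 =>
    let t := T r c in
    let here := (r, c, ~~ top) in
    let out : option bool (* Some true = exit bottom, Some false = exit left *) :=
      if top then
        match t with Cross | Vert => Some true | ElbowTL => Some false | _ => None end
      else
        match t with Cross | Horiz => Some false | ElbowRB => Some true | _ => None end in
    match out with
    | None => ([:: here], None)
    | Some true =>
        if r.+1 == k then ([:: here], Some c)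
        else let p := walk T k f r.+1 c true in (here :: p.1, p.2)
    | Some false =>
        if c is c'.+1 then let p := walk T k f r c' false in (here :: p.1, p.2)
        else ([:: here], None)
    end
  end.

Definition pipe n (D : grid n) (k i : nat) :=
  walk (tileAt D) k (k + n).+1 i n.-1 false.

Definition pipe_cells n (D : grid n) (k i : nat) : seq (nat * nat) :=
  [seq (x.1.1, x.1.2) | x <- (pipe D k i).1].

Definition exit_col n (D : grid n) (k i : nat) : option nat := (pipe D k i).2.

Definition crossings n (D : grid n) (i j : nat) : nat :=
  count (fun rc => (rc \in pipe_cells D n j) && (tileAt D rc.1 rc.2 == Cross))
        (pipe_cells D n i).

Definition is_nrow_BPD n (D : grid n) : Prop :=
  [/\
      (forall r c, r < n -> c.+1 < n -> hasR (tileAt D r c) = hasL (tileAt D r c.+1)),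
      (forall r c, r.+1 < n -> c < n -> hasB (tileAt D r c) = hasT (tileAt D r.+1 c)),
      (forall r, r < n -> ~~ hasL (tileAt D r 0)),
      (forall c, c < n -> ~~ hasT (tileAt D 0 c)) &
      (forall r, r < n -> hasR (tileAt D r n.-1))] /\
      (forall i j, i < j < n -> crossings D i j <= 1).

Definition assoc_k n (D : grid n) (k : nat) (u : 'S_n) : bool :=
  [forall i : 'I_n, (i < k) ==> (exit_col D k i == Some (val (u i)))] &&
  [forall i : 'I_n, forall j : 'I_n, ((k <= i) && (i < j)) ==> (u j < u i)].

Definition is_BPD n (w : 'S_n) (D : grid n) : Prop := is_nrow_BPD D /\ assoc_k D n w.

Definition u_k n (D : grid n) (k : nat) : 'S_n := odflt 1%g [pick u | assoc_k D k u].

Definition chain_BPD n (D : grid n) : seq 'S_n := [seq u_k D (n.-1 - s) | s <- iota 0 n].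

Definition blanks n (D : grid n) (r : nat) : nat := #|[set c : 'I_n | tileAt D r c == Blank]|.
Definition wt_BPD n (D : grid n) : seq nat := [seq blanks D r | r <- iota 0 n.-1].

(* Main.v *)
Require Import Defs.
From mathcomp Require Import all_boot all_order all_algebra all_fingroup.
From mathcomp Require Import zify.
Set Implicit Arguments. Unset Strict Implicit. Unset Printing Implicit Defensive.

(* In one row of a bumpless pipe dream, let v and u be the permutations above
   and below the row.  The pipes that move do so along pairwise disjoint
   horizontal segments, and the pipes they cross are vertical.  Since a pipe
   enters to the right of all earlier ones, two pipes cross at most once exactly
   when a horizontal pipe never crosses a later pipe; this is the condition
   that no value lies in between in a Bruhat cover.  Reading the moving
   segments from left to right, and within a segment the columns that are empty
   above, one obtains an increasing chain from u to v with one step for each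
   unoccupied nonblank column but the last.  Conversely, the descents of v force the
   exchanged values of an increasing chain to form disjoint intervals.  The
   tiles of a row are determined by the columns occupied above and below it. *)

Local Open Scope nat_scope.

(** * Length and Bruhat covers *)

Lemma perm_val_inj n (u : 'S_n) (p q : 'I_n) : u p = u q :> nat -> p = q.
Proof. by move=> e; apply: (@perm_inj _ u); apply: val_inj. Qed.

Section Length.
Variable n : nat.
Implicit Types u v : 'S_n.

Let inv u := [set p : 'I_n * 'I_n | (p.1 < p.2) && (u p.2 < u p.1)].

Definition flipped (i j : 'I_n) : {set 'I_n * 'I_n} :=
  [set p : 'I_n * 'I_n | (p.1 < p.2) && (tperm i j p.2 < tperm i j p.1)].

Lemma tperm_nat (i j x : 'I_n) :
  tperm i j x = (if x == i :> nat then j else if x == j :> nat then i else x) :> nat.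
Proof. by rewrite !val_eqE; case: tpermP => [->|->|/eqP/negPf-> /eqP/negPf->]; rewrite ?eqxx //; case: eqP => [->|]. Qed.

Lemma tpermDn (i j x : 'I_n) : x <> i :> nat -> x <> j :> nat -> tperm i j x = x.
Proof. by move=> /eqP/negPf xi /eqP/negPf xj; apply: val_inj; rewrite /= tperm_nat xi xj. Qed.

Lemma flippedP (i j x y : 'I_n) : i < j ->
  reflect (x < y /\ ((x = i /\ y <= j) \/ (y = j /\ i <= x)))
          ((x, y) \in flipped i j).
Proof.
move=> ij; rewrite inE /= !tperm_nat.
apply: (iffP andP) => -[xy].
  case: (nat_of_ord y =P i) => [/val_inj ?|yi]; case: (nat_of_ord x =P i) => [/val_inj ?|xi];
    subst; rewrite ?ltnn //.
  - by case: (nat_of_ord x =P j) => [/val_inj ?|xj] h; exfalso; subst; lia.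
  - by case: (nat_of_ord y =P j) => [/val_inj ?|yj] h; split=> //; left; subst; split=> //; lia.
  case: (nat_of_ord y =P j) => [/val_inj ?|yj]; case: (nat_of_ord x =P j) => [/val_inj ?|xj] h;
    subst; try by exfalso; lia.
  by split=> //; right; split=> //; lia.
case=> -[? le]; subst; split=> //; rewrite eqxx.
  case: (nat_of_ord y =P i) => [/val_inj ?|yi]; first by subst; lia.
  by case: (nat_of_ord y =P j) => [/val_inj ?|yj]; subst; lia.
case: (nat_of_ord j =P i) => [/val_inj ?|ji]; first by subst; lia.
case: (nat_of_ord x =P i) => [/val_inj ?|xi]; first by subst.
by case: (nat_of_ord x =P j) => [/val_inj ?|xj]; subst; lia.
Qed.

(** The transposition, applied to both coordinates, carries the inversions of [u] outside
    [flipped i j] onto those of [v] outside it. On flipped pairs every inversion of [u] remains one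
    of [v], because [u i < u j]. *)
Lemma len_tperm u v (i j : 'I_n) : i < j -> u i < u j ->
  (forall x, v x = u (tperm i j x)) ->
  len v = len u + #|(inv v :\: inv u) :&: flipped i j|.
Proof.
move=> ij uij ve; rewrite /len -/(inv u) -/(inv v).
rewrite -(cardsID (flipped i j) (inv v)) -(cardsID (flipped i j) (inv u)).
set s := fun p : 'I_n * 'I_n => (tperm i j p.1, tperm i j p.2).
have sK : involutive s by case=> x y; rewrite /s /= !tpermK.
have sub : inv u :&: flipped i j \subset inv v :&: flipped i j.
  apply/subsetP=> -[x y]; rewrite in_setI => /andP[]; rewrite inE /= => /andP[xy uxy] fl.
  rewrite in_setI fl andbT inE /= xy /= !ve.
  case/(flippedP _ _ ij): fl => _ [[? yj]|[? ix]]; subst.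
    rewrite tpermL; case: (tpermP i j y) => [?|?|_ _]; subst=> //; lia.
  rewrite tpermR; case: (tpermP i j x) => [?|?|_ _]; subst=> //; lia.
have -> : #|inv v :\: flipped i j| = #|inv u :\: flipped i j|.
  have -> : inv v :\: flipped i j = s @: (inv u :\: flipped i j).
    apply/setP=> p; rewrite -[in RHS](sK p) (mem_imset _ _ (inv_inj sK)).
    case: p => x y; rewrite !inE /s /= !ve !tpermK.
    case: (ltngtP x y) => [xy|xy|/val_inj->] /=; rewrite ?ltnn ?andbF //.
      by case: (ltngtP (tperm i j x) (tperm i j y)) => // /val_inj->; rewrite ltnn.
    by case: (tperm i j x < _).
  by rewrite card_imset //; apply: inv_inj.
rewrite (_ : (_ :\: _) :&: _ = (inv v :&: flipped i j) :\: (inv u :&: flipped i j)); last first.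
  by apply/setP=> p; rewrite !(in_setI, in_setD); do 3!case: (_ \in _).
by rewrite (cardsD (inv v :&: _)) (setIidPr sub) addnAC subnKC // subset_leq_card.
Qed.

(** If [u i < u j], the pair [(i, j)] is a new inversion. Any other new flipped one is [(i, x)] or
    [(x, j)] for an intermediate position [x] with intermediate value, so the increase is one
    exactly when there is no such [x]. *)
Lemma len_cover u v (i j : 'I_n) : i < j ->
  (forall x, v x = u (tperm i j x)) ->
  len v = (len u).+1 <->
  u i < u j /\ (forall x : 'I_n, i < x < j -> u i < u x < u j -> False).
Proof.
move=> ij ve.
have vi : v i = u j by rewrite ve tpermL.
have vj : v j = u i by rewrite ve tpermR.
have nij : i <> j by move=> e; rewrite e ltnn in ij.
have uE : forall x, u x = v (tperm i j x) by move=> x; rewrite ve tpermK.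
split=> [lv|[uij nb]]; last first.
  rewrite (len_tperm ij uij ve) (_ : _ :&: _ = [set (i, j)]) ?cards1 ?addn1 //.
  apply/setP=> -[x y]; rewrite in_set1 in_setI; apply/idP/eqP.
    case/andP => + /(flippedP _ _ ij) [_ fl]; rewrite !inE /= => /andP[nu /andP[xy vxy]].
    rewrite xy /= -leqNgt in nu.
    case: fl => -[? le]; subst.
      congr pair; apply: val_inj => /=; apply/eqP; rewrite eqn_leq le /= leqNgt; apply/negP=> lt.
      apply: (nb y); first lia.
      have vy : v y = u y by rewrite ve tpermDn //; lia.
      rewrite vi vy in vxy; have : u i <> u y by move=> /perm_inj e; subst; rewrite ltnn in xy.
      by move=> /eqP; rewrite -val_eqE /= in nu *; lia.
    congr pair; apply: val_inj => /=; apply/eqP; rewrite eqn_leq le andbT leqNgt; apply/negP=> lt.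
    apply: (nb x); first lia.
    have vx : v x = u x by rewrite ve tpermDn //; lia.
    rewrite vj vx in vxy; have : u x <> u j by move=> /perm_inj e; subst; rewrite ltnn in xy.
    by move=> /eqP; rewrite -val_eqE /= in nu *; lia.
  case=> -> ->; rewrite !inE /= ij vi vj uij !tpermL !tpermR ij /=.
  lia.
(* Otherwise [len_tperm] with [u] and [v] exchanged would make [v] the shorter one. *)
have uij : u i < u j.
  rewrite ltnNge; apply/negP; rewrite leq_eqVlt => /orP[/eqP/perm_val_inj e|lt]; first by case: nij.
  have := @len_tperm v u i j ij; rewrite vi vj => /(_ lt uE); lia.
split=> // x bx vx; move: lv; rewrite (len_tperm ij uij ve) => /eqP.
rewrite -addn1 eqn_add2l => /cards1P[p e].
have vxe : v x = u x.
  by rewrite ve tpermDn //; lia.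
have h1 : (i, j) \in [set p].
  rewrite -e !inE /= ij vi vj uij !tpermL !tpermR ij /=; lia.
have h2 : (i, x) \in [set p].
  rewrite -e in_setI; apply/andP; split; last by apply/flippedP => //=; split; [lia|left; split=> //; lia].
  rewrite !inE /= vi vxe; lia.
move: h1 h2; rewrite !in_set1 => /eqP <- /eqP [e2]; subst; rewrite ltnn andbF in bx.
by [].
Qed.

End Length.

(** * Rows and increasing chains *)

Definition desc n (k : nat) (u : 'S_n) : Prop :=
  forall i j : 'I_n, k <= i -> i < j -> u j < u i.

(* u and v are the permutations below and above row m of a bumpless pipe
   dream.  Pipe q runs horizontally from column v q to column u q; moving pipes
   occupy disjoint segments, and a moving pipe only crosses earlier pipes. *)
Record row_step n (m : nat) (u v : 'S_n) : Prop := RowStep {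
  row_le : forall q : 'I_n, q <= m -> u q <= v q;
  row_disjoint : forall p q : 'I_n, p <= m -> q <= m -> u p < v p -> u q < v q ->
    p <> q :> nat -> v p < u q \/ v q < u p;
  row_cross : forall p q : 'I_n, p <= m -> q <= m ->
    u p < u q < v p -> u q = v q :> nat -> q < p;
  row_desc_top : desc m v;
  row_desc_bot : desc m.+1 u }.

(** The index [lo] bounds the smaller value exchanged at the first step from below, which builds the
    increasing condition into the induction; the last index counts the steps. *)
Inductive kpath n (k : nat) : nat -> 'S_n -> 'S_n -> nat -> Prop :=
  | kpath0 lo u : kpath k lo u u 0
  | kpathS lo u u' v d i j : kcover k u u' i j -> lo <= u i ->
      kpath k (u i).+1 u' v d -> kpath k lo u v d.+1.

Section RowStep.
Variables (n m : nat).
Implicit Types (u v : 'S_n) (p q i j : 'I_n).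

(** A position [y <= m] ending in the column that [q] leaves would either move, and its segment
    would touch that of [q], or stay, and then share the value [v q] with [q]. *)
Lemma row_top_beyond u v q (y : 'I_n) : row_step m u v -> q <= m -> u q < v q -> u y = v q -> m < y.
Proof.
move=> R qm qv ey; have ey' : u y = v q :> nat by rewrite ey.
rewrite ltnNge; apply/negP=> ym.
case: (nat_of_ord y =P q) => [/val_inj e|yq]; first by rewrite -ey e ltnn in qv.
case: (ltngtP (u y) (v y)) (row_le R ym) => // [lt|/val_inj e] _.
  by case: (row_disjoint R ym qm lt qv yq); lia.
by apply: yq; congr nat_of_ord; apply: (@perm_inj _ v); rewrite -e.
Qed.

Lemma row_bot_beyond u v q (y : 'I_n) : row_step m u v -> q <= m -> u q < v q -> v y = u q -> m < y.
Proof.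
move=> R qm qv ey; have ey' : v y = u q :> nat by rewrite ey.
rewrite ltnNge; apply/negP=> ym.
case: (nat_of_ord y =P q) => [/val_inj e|yq]; first by rewrite -ey e ltnn in qv.
case: (ltngtP (u y) (v y)) (row_le R ym) => // [lt|/val_inj e] _.
  by case: (row_disjoint R ym qm lt qv yq); lia.
by apply: yq; congr nat_of_ord; apply: (@perm_inj _ u); rewrite e.
Qed.

Lemma kcoverP u v i j : kcover m.+1 u v i j ->
  [/\ i <= m < j, u i < u j, v i = u j /\ v j = u i,
      (forall x : 'I_n, x <> i :> nat -> x <> j :> nat -> v x = u x) &
      (forall x : 'I_n, i < x < j -> u i < u x < u j -> False)].
Proof.
case=> ij im ve lv; have [uij nb] := (len_cover ij ve).1 lv; split=> //.
- by rewrite !ve tpermL tpermR.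
- by move=> x xi xj; rewrite ve tpermDn.
Qed.

Lemma kcover_min u v i j : kcover m.+1 u v i j -> minn (u i) (u j) = u i.
Proof. by move=> /kcoverP[_ lt _ _ _]; apply/minn_idPl/ltnW. Qed.

Lemma inc_kchain_kpath u v : inc_kchain m.+1 u v -> exists d, kpath m.+1 0 u v d.
Proof.
case=> d [vs [ii [jj [<- <- cov inc]]]]; exists d.
have {}inc : forall s, s.+1 < d -> vs s (ii s) < vs s.+1 (ii s.+1).
  move=> s sd; have := inc s sd.
  by rewrite (kcover_min (cov _ sd)) (kcover_min (cov _ (ltnW sd))).
suff: forall lo, (0 < d -> lo <= vs 0 (ii 0)) -> kpath m.+1 lo (vs 0) (vs d) d by apply.
elim: d vs ii jj cov inc => [|d IH] vs ii jj cov inc lo lo_le; first by constructor.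
apply: (kpathS (cov 0 isT)); first exact: lo_le.
apply: (IH (vs \o S) (ii \o S) (jj \o S)) => [s sd|s sd|d0] /=.
- exact: cov.
- exact: inc.
- exact: inc.
Qed.

Lemma kpath_inc_kchain lo u v d : 0 < n -> kpath m.+1 lo u v d -> inc_kchain m.+1 u v.
Proof.
move=> n0 h; exists d.
suff [vs [ii [jj [v0 vd cov inc _]]]] : exists (vs : nat -> 'S_n) (ii jj : nat -> 'I_n),
    [/\ vs 0 = u, vs d = v,
        (forall s, s < d -> kcover m.+1 (vs s) (vs s.+1) (ii s) (jj s)),
        (forall s, s.+1 < d -> vs s (ii s) < vs s.+1 (ii s.+1)) &
        0 < d -> lo <= vs 0 (ii 0)].
  exists vs, ii, jj; split=> // s sd.
  by rewrite (kcover_min (cov _ sd)) (kcover_min (cov _ (ltnW sd))); apply: inc.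
elim: h => {lo u v d} [lo u|lo u u' v d i j c le _ [vs [ii [jj [v0 vd cov inc lo1]]]]].
  (* A chain without steps still needs position functions; position 0 is a dummy value. *)
  by exists (fun=> u), (fun=> Ordinal n0), (fun=> Ordinal n0); split.
exists (fun s => if s is s'.+1 then vs s' else u), (fun s => if s is s'.+1 then ii s' else i),
  (fun s => if s is s'.+1 then jj s' else j); split=> //.
- by case=> [_|s sd]; [rewrite v0|apply: cov].
- by case=> [|s] sd; [apply: lo1|apply: inc].
Qed.

Lemma kpath_len lo u v d : kpath m.+1 lo u v d -> len v = len u + d.
Proof. by elim=> [*|{}lo {}u u' {}v {}d i j [_ _ _ e] _ _ ->]; rewrite ?addn0 // e addnS. Qed.

(** Undoing a cover raises the value at [j]. If this destroyed a descent from some [x] with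
    [m < x < j], then [u x] would lie between [u i] and [u j], which the cover forbids. *)
Lemma desc_kpath lo u v d : kpath m.+1 lo u v d -> desc m.+1 v -> desc m.+1 u.
Proof.
elim=> // {}lo {}u u' {}v {}d i j /kcoverP[im uij [vi vj] vx nb] _ _ IH /IH dv x y mx xy.
have := dv x y mx xy.
case: (nat_of_ord x =P j) => [/val_inj ?|xj]; case: (nat_of_ord y =P j) => [/val_inj ?|yj]; subst.
- lia.
- rewrite vj (vx y) //; lia.
- rewrite (vx x) //; last by lia.
  rewrite vj => lt; rewrite ltnNge; apply/negP=> le.
  have ne : u x <> u j by move/perm_inj => e; apply: xj; rewrite e.
  apply: (nb x); first lia.
  have : u x <> u j :> nat by move/val_inj.
  lia.
- by rewrite !vx //; lia.
Qed.

(* If a moving q had u' q strictly below b := u' i, then i would cross q and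
   hence q < i; the value v q, which sits at a position beyond m in u',
   then either contradicts the cover u <. u' or the descents of u'. *)
Lemma kpath_row lo u v d : desc m v -> kpath m.+1 lo u v d ->
  row_step m u v /\ forall q, q <= m -> u q < v q -> lo <= u q.
Proof.
move=> dv h; elim: h dv => {lo u v d} [lo u|lo u u' v d i j c lou p IH] dv.
  split=> [|q _]; last by rewrite ltnn.
  by split=> // [p q _ _|p q _ _ ?|i j mi ij]; [rewrite ltnn|lia|apply: dv => //; apply: ltnW].
have du := desc_kpath (kpathS c lou p).
have [R lo'] := IH dv.
have [im uij [vi vj] vx nb] := kcoverP c.
have dv' : desc m.+1 v by move=> x y mx; apply: dv; apply: ltnW.
have {}du := du dv'.
have bound : forall q, q <= m -> u' q < v q -> q <> i :> nat -> u' i < u' q.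
  move=> q qm qv qi; rewrite ltnNge; apply/negP => le.
  have lt : u' q < u' i.
    by rewrite ltn_neqAle le andbT; apply/negP => /eqP /perm_val_inj e; apply: qi; rewrite e.
  have uq : u' q = u q by apply: vx => //; lia.
  have ltq := lo' q qm qv.
  have qi' : q < i.
    rewrite ltnNge; apply/negP => iq; apply: (nb q); first lia.
    by move: lt ltq; rewrite vi uq; lia.
  pose y := (u'^-1 (v q))%g; have ey : u' y = v q by rewrite permKV.
  have ey' : u' y = v q :> nat by rewrite ey.
  have my := row_top_beyond R qm qv ey.
  have yb : u' y < u' i.
    rewrite ltn_neqAle; apply/andP; split.
      by apply/eqP => /perm_val_inj e; rewrite e in my; lia.
    rewrite leqNgt; apply/negP => gt.
    have ile : i <= m by lia.
    case: (ltngtP (u' i) (v i)) (row_le R ile) => // [lt1|e] _.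
      by case: (row_disjoint R ile qm lt1 qv); try lia; lia.
    by have := row_cross R qm ile; rewrite -ey lt gt => /(_ isT e); lia.
  have yj : y <> j :> nat.
    by move/val_inj => e; move: ey qv; rewrite e vj => <-; lia.
  have uy : u' y = u y by apply: vx => //; lia.
  have jy : j < y.
    rewrite ltnNge; apply/negP => yj'; apply: (nb y); first lia.
    by rewrite -uy -vi yb andbT ey; lia.
  have := row_desc_bot R _ jy; rewrite vj ey; lia.
have ile : i <= m by lia.
have leb := row_le R ile.
have nm : forall q, q <= m -> q <> i :> nat -> u' q = u q by move=> q qm qi; apply: vx => //; lia.
split; last first.
  move=> q qm qv; case: (nat_of_ord q =P i) => [/val_inj->//|qi].
  have := bound q qm; rewrite nm // => /(_ qv qi); rewrite vi; lia.
split=> //.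
- move=> q qm; case: (nat_of_ord q =P i) => [/val_inj->|qi]; first by rewrite vi in leb; lia.
  by rewrite -nm //; apply: (row_le R).
(* By [bound] and disjointness for [u'], every other moving segment starts beyond [v i], so the
   lengthened segment of [i] meets none of them. *)
- have key : forall q, q <= m -> u q < v q -> q <> i :> nat -> v i < u q.
    move=> q qm qv qi; rewrite -nm // in qv *; have b := bound q qm qv qi.
    case: (ltngtP (u' i) (v i)) leb => // [lt _|<-//].
    by case: (row_disjoint R ile qm lt qv); lia.
  move=> x y xm ym ux uy xy.
  case: (nat_of_ord x =P i) => [/val_inj ?|xi]; first by subst; left; apply: key => //; lia.
  case: (nat_of_ord y =P i) => [/val_inj ?|yi]; first by subst; right; apply: key => //; lia.
  by rewrite -(nm x) // -(nm y) //; apply: (row_disjoint R); rewrite ?nm.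
- move=> x y xm ym uxy ey.
  case: (nat_of_ord y =P i) => [/val_inj ?|yi]; first by subst; rewrite vi in leb; lia.
  case: (nat_of_ord x =P i) => [/val_inj ?|xi]; last first.
    by apply: (row_cross R); rewrite ?nm.
  (* The segment of [i] splits at [u' i]: to its left the cover forces [y < i], to its right
     [row_cross] for [u'] does. *)
  subst x; case: (ltngtP (u' y) (u' i)) => [lt|gt|/perm_val_inj e]; last by rewrite e in yi.
    rewrite ltnNge; apply/negP => iy; apply: (nb y); first lia.
    by move: lt; rewrite vi nm //; lia.
  by apply: (row_cross R ile ym); [move: gt uxy; rewrite (nm y) //; lia|rewrite nm].
Qed.

End RowStep.

(** At the first disagreement, the larger of the two values occurs at a later position of the other
    permutation, against its descents. *)
Lemma desc_uniq n k (u v : 'S_n) : desc k u -> desc k v ->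
  (forall i : 'I_n, i < k -> u i = v i) -> u = v.
Proof.
move=> du dv uv.
suff H : forall t (i : 'I_n), i < t -> u i = v i by apply/permP => i; apply: (H i.+1).
have half (f g : 'S_n) t (i : 'I_n) : desc k g -> k <= i -> nat_of_ord i = t ->
    (forall x : 'I_n, x < t -> f x = g x) -> g i < f i -> False.
  move=> dg ki it IH lt.
  pose y := (g^-1 (f i))%g; have ey : g y = f i by rewrite permKV.
  case: (ltngtP y i) => [yi|iy|/val_inj e]; last by rewrite -ey e ltnn in lt.
    by have := IH y; rewrite -it yi ey => /(_ isT)/perm_inj e; rewrite e ltnn in yi.
  by have := dg _ _ ki iy; rewrite ey; lia.
elim=> // t IH i; rewrite ltnS leq_eqVlt => /orP[/eqP it|]; last exact: IH.
case: (ltnP i k) => ik; first exact: uv.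
case: (ltngtP (u i) (v i)) => [lt|lt|/val_inj//]; exfalso.
  by apply: (half v u t i) => // x /IH.
by apply: (half u v t i) => // x /IH.
Qed.

(* The smaller values exchanged along the increasing chain from u to v. *)
Definition moved n (m : nat) (u v : 'S_n) : {set 'I_n} :=
  [set c | (m < (v^-1 c)%g) && [exists p : 'I_n, (p <= m) && (u p <= c < v p)]].

Section RowTheory.
Variables (n m : nat).
Implicit Types (u v : 'S_n) (p q i j : 'I_n).

Lemma movedP u v (c : 'I_n) :
  reflect (m < (v^-1 c)%g /\ exists p : 'I_n, p <= m /\ u p <= c < v p) (c \in moved m u v).
Proof.
rewrite inE; apply: (iffP andP) => -[h H]; split=> //.
  by case/existsP: H => p /andP[]; exists p.
by case: H => p [pm pc]; apply/existsP; exists p; rewrite pm.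
Qed.

Lemma row_between u v p (y : 'I_n) : row_step m u v -> p <= m -> y <= m -> y <> p ->
  u p < u y < v p -> u y = v y /\ y < p.
Proof.
move=> R pm ym yp b; have yp' : p <> y :> nat by move=> /val_inj e; apply: yp.
case: (ltngtP (u y) (v y)) (row_le R ym) => // [lt|e] _.
  by have := row_disjoint R pm ym; lia.
by split; [apply: val_inj|apply: (row_cross R pm ym b e)].
Qed.

(** Induction on the number of moved columns. The first step takes the moving [p] with leftmost
    [u p] and exchanges it with the position [j] beyond [m] that has the next larger value. Values
    in between belong to stationary pipes at positions before [p], so this is a cover. *)
Lemma row_kpath lo u v : row_step m u v ->
  (forall q, q <= m -> u q < v q -> lo <= u q) -> kpath m.+1 lo u v #|moved m u v|.
Proof.
move: {2}#|_| (erefl #|moved m u v|) => k; elim: k u lo => [|k IH] u lo ek R lo_le; rewrite ek.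
  suff -> : u = v by constructor.
  apply: (@desc_uniq _ m.+1); [exact: row_desc_bot R|by move=> x y mx; apply: (row_desc_top R); apply: ltnW|].
  move=> i im; case: (ltngtP (u i) (v i)) (row_le R im) => // [lt _|/val_inj//].
  have : u i \in moved m u v.
    apply/movedP; split; last by exists i; rewrite leqnn lt.
    by apply: (row_bot_beyond R im lt); rewrite permKV.
  by rewrite (cards0_eq ek) inE.
have [p [pm pv pmin]] : exists p : 'I_n, [/\ p <= m, u p < v p & forall q, q <= m -> u q < v q -> u p <= u q].
  have : 0 < #|moved m u v| by rewrite ek.
  case/card_gt0P => c /movedP[_ [p0 [p0m p0c]]].
  have h0 : (p0 <= m) && (u p0 < v p0) by lia.
  case: (arg_minnP (P := fun p => (p <= m) && (u p < v p)) (fun p => u p) h0) => p /andP[pm pv] pmin.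
  by exists p; split=> // q qm qv; apply: pmin; rewrite qm.
(* The value [v p] sits beyond [m] in [u], so [j] exists and does not overshoot the segment of
   [p]. *)
have [j [mj pj jv jmin]] : exists j : 'I_n, [/\ m < j, u p < u j, u j <= v p &
    forall y : 'I_n, m < y -> u p < u y -> u j <= u y].
  pose j0 := (u^-1 (v p))%g; have e0 : u j0 = v p by rewrite permKV.
  have h0 : (m < j0) && (u p < u j0) by rewrite (row_top_beyond R pm pv e0) e0.
  case: (arg_minnP (P := fun j : 'I_n => (m < j) && (u p < u j)) (fun j => u j) h0) => j /andP[mj pj] jmin.
  exists j; split=> // [|y my py]; first by rewrite -e0; apply: jmin.
  by apply: jmin; rewrite my.
pose u' : 'S_n := (tperm p j * u)%g.
have ue x : u' x = u (tperm p j x) by rewrite permM.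
clearbody u'.
have u'p : u' p = u j by rewrite ue tpermL.
have u'j : u' j = u p by rewrite ue tpermR.
have u'x (x : 'I_n) : x <> p :> nat -> x <> j :> nat -> u' x = u x by move=> xp xj; rewrite ue tpermDn.
have low (x : 'I_n) : x <= m -> x <> p :> nat -> u' x = u x by move=> xm xp; apply: u'x => //; lia.
have gap (y : 'I_n) : u p < u y < u j -> y <= m /\ u y = v y.
  move=> b; have ym : y <= m by rewrite leqNgt; apply/negP => my; have := jmin y my; lia.
  have yp : y <> p by move=> e; rewrite e in b; lia.
  by split=> //; apply: (proj1 (row_between R pm ym yp _)); lia.
have c : kcover m.+1 u u' p j.
  have ltpj : p < j by lia.
  split=> //; first by lia.
  apply/(len_cover ltpj ue); split=> // x xpj b.
  have [xm _] := gap _ b.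
  have xp : x <> p by move=> e; rewrite e in xpj; lia.
  have [] := row_between R pm xm xp; lia.
have ge (q : 'I_n) : q <= m -> u q <= u' q.
  move=> qm; case: (nat_of_ord q =P p) => [/val_inj->|qp]; first by rewrite u'p ltnW.
  by rewrite low.
have R' : row_step m u' v.
  split.
  - move=> q qm; case: (nat_of_ord q =P p) => [/val_inj->|qp]; first by rewrite u'p.
    by rewrite low //; apply: (row_le R).
  - move=> x y xm ym ux uy xy; have := ge _ xm; have := ge _ ym => gy gx.
    have := row_disjoint R xm ym; lia.
  - move=> x y xm ym b e; have gx := ge _ xm.
    case: (nat_of_ord y =P p) => [/val_inj ey|yp]; last first.
      by rewrite (low y) // in b e; apply: (row_cross R xm ym) => //; lia.
    subst y; case: (nat_of_ord x =P p) => [/val_inj ex|xp]; first by subst x; lia.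
    have := row_disjoint R xm pm; rewrite low // in b; lia.
  - exact: row_desc_top R.
  move=> x y mx xy; have dxy := row_desc_bot R mx xy.
  case: (nat_of_ord x =P j) => [/val_inj ex|xj].
    subst x; rewrite u'j u'x; try lia.
    have ne : u y <> u p :> nat by move/perm_val_inj => e; rewrite e in xy; lia.
    by have := jmin y; lia.
  case: (nat_of_ord y =P j) => [/val_inj ey|yj].
    by subst y; rewrite u'j u'x; lia.
  by rewrite !u'x; lia.
have upH : u p \in moved m u v.
  apply/movedP; split; last by exists p; rewrite leqnn pv.
  by apply: (row_bot_beyond R pm pv); rewrite permKV.
(* The segment of [p] now starts at [u j]. The columns strictly between [u p] and [u j] carry
   stationary pipes, so only [u p] leaves [moved]. *)
have H : moved m u' v = moved m u v :\ u p.
  apply/setP => x; rewrite in_setD1; apply/movedP/andP => [[vx [q [qm b]]]|[xp /movedP[vx [q [qm b]]]]].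
    have gq := ge _ qm; split; last by apply/movedP; split=> //; exists q; lia.
    apply/eqP => e; subst x.
    case: (nat_of_ord q =P p) => [/val_inj e|qp]; first by subst q; rewrite u'p in b; lia.
    by have := row_disjoint R qm pm; lia.
  split=> //; exists q; split=> //.
  case: (nat_of_ord q =P p) => [/val_inj e|qp]; last by rewrite low.
  subst q; rewrite u'p; case/andP: b => b1 ->; rewrite andbT leqNgt; apply/negP => b2.
  have e : u (u^-1 x)%g = x by rewrite permKV.
  have lt : u p < x by rewrite ltn_neqAle b1 andbT eq_sym; exact: xp.
  have [|ym yv] := gap (u^-1 x)%g; first by rewrite e lt.
  have ex : (v^-1 x = u^-1 x)%g by apply: (@perm_inj _ v); rewrite permKV -yv e.
  by rewrite ex ltnNge ym in vx.
have k' : #|moved m u' v| = k.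
  by have := cardsD1 (u p) (moved m u v); rewrite upH ek H; lia.
apply: (kpathS c); first exact: lo_le.
rewrite -k'; apply: IH => // q qm qv.
case: (nat_of_ord q =P p) => [/val_inj->|qp]; first by rewrite u'p.
rewrite low // in qv *; rewrite ltn_neqAle pmin // andbT.
by apply/eqP => /perm_val_inj e; rewrite e in qp.
Qed.

(** A moving pipe needs a position beyond [m] by [row_bot_beyond], and the last row has none. Hence
    a chain that begins with the permutation above the last row begins with [w]. *)
Lemma row_last u v : n = m.+1 -> row_step m u v -> u = v.
Proof.
move=> nm R; apply: (@desc_uniq _ m.+1).
- exact: row_desc_bot R.
- by move=> x y mx; apply: (row_desc_top R); apply: ltnW.
move=> q qm; case: (ltngtP (u q) (v q)) (row_le R qm) => // [lt _|/val_inj//].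
have := row_bot_beyond R qm lt (permKV v (u q)).
by have := ltn_ord (v^-1 (u q))%g; lia.
Qed.

Lemma row_refl u : n = m.+1 -> row_step m u u.
Proof.
move=> nm; split=> [//|p q _ _|p q _ _|x y mx xy|x y mx xy]; try by rewrite ?ltnn; lia.
- by have := ltn_ord y; lia.
- by have := ltn_ord x; lia.
Qed.

(* The column from which pipe p comes down or enters row m; column n stands
   for the right boundary, through which pipe m enters. *)
Definition entry v (p : 'I_n) : nat := if p == m :> nat then n else v p.

Lemma entry_ne v p : p <> m :> nat -> entry v p = v p.
Proof. by rewrite /entry => /eqP/negPf->. Qed.

Lemma entry_eq v p : p = m :> nat -> entry v p = n.
Proof. by rewrite /entry => ->; rewrite eqxx. Qed.

Lemma row_le_entry u v q : row_step m u v -> q <= m -> u q <= entry v q.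
Proof.
move=> R qm; case: (nat_of_ord q =P m) => e; first by rewrite entry_eq // ltnW.
by rewrite entry_ne //; apply: (row_le R).
Qed.

(** The segment of pipe [m] extends to the right boundary, so others must end before it. In [v] the
    column [u q] is held beyond [m], so the descents give [u q < v p]; then [row_disjoint] or
    [row_cross] excludes [u p <= v q]. *)
Lemma row_disjoint_last u v p q : row_step m u v -> p = m :> nat -> q < m ->
  u q < v q -> v q < u p.
Proof.
move=> R pm qm lt; have pm' : p <= m by rewrite pm.
have e := permKV v (u q); have my := row_bot_beyond R (ltnW qm) lt e.
have py : p < (v^-1 (u q))%g by rewrite pm.
have := row_desc_top R _ py; rewrite pm leqnn e => /(_ isT) lp.
have qp : q <> p :> nat by lia.
case: (ltngtP (u p) (v p)) (row_le R pm') => // [ltp|eqp] _.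
  by have := row_disjoint R (ltnW qm) pm' lt ltp qp; lia.
rewrite ltnNge; apply/negP => le.
have : u p <> v q :> nat by rewrite eqp => /perm_val_inj e'; rewrite e' in qp.
by have := row_cross R (ltnW qm) pm'; lia.
Qed.

Lemma row_disjoint_entry u v p q : row_step m u v -> p <= m -> q <= m ->
  u p < entry v p -> u q < entry v q -> p <> q :> nat ->
  entry v p < u q \/ entry v q < u p.
Proof.
move=> R pm qm; case: (nat_of_ord p =P m) => ep; case: (nat_of_ord q =P m) => eq.
- by lia.
- rewrite (entry_ne v eq) => _ lt _; right; apply: (row_disjoint_last R) => //; lia.
- rewrite (entry_ne v ep) => lt _ _; left; apply: (row_disjoint_last R) => //; lia.
- by rewrite !entry_ne //; apply: (row_disjoint R).
Qed.

End RowTheory.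

(** * Pipes of a grid *)

Definition glide n (t : nat -> tile) (x y : nat) : Prop :=
  [/\ y < x <= n, t y = ElbowRB, (x < n -> t x = ElbowTL) &
      forall z, y < z < x -> hasL (t z) && hasR (t z)].

(* A pipe coming down in column x, or entering from the right if x = n,
   leaves the row t through the bottom edge of column y. *)
Definition run n (t : nat -> tile) (x y : nat) : Prop :=
  (x = y /\ x < n /\ hasT (t x) && hasB (t x)) \/ glide n t x y.

Definition row_match n (t : nat -> tile) : Prop :=
  [/\ forall c, c.+1 < n -> hasR (t c) = hasL (t c.+1), ~~ hasL (t 0) & hasR (t n.-1)].

Section Run.
Variables (n : nat) (t : nat -> tile).

(** A tile with a right edge is an [ElbowRB] or has a left edge too, and column 0 has no left edge;
    so following the segment leftwards ends at the elbow. *)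
Lemma right_source k : row_match n t -> k < n -> hasR (t k) ->
  exists y, [/\ y <= k, t y = ElbowRB & forall z, y < z <= k -> hasL (t z) && hasR (t z)].
Proof.
case=> edge left _; elim: k => [|k IH] kn Rk.
  by exists 0; split=> // [|z]; [move: Rk left; case: (t 0)|lia].
case Lk : (hasL (t k.+1)); last first.
  by exists k.+1; split=> // [|z]; [move: Rk Lk; case: (t _)|lia].
have [||y [yk ty bet]] := IH; [lia|by rewrite edge|].
exists y; split=> // [|z]; first by apply: ltnW.
by case: (z =P k.+1) => [-> _|zk yz]; [rewrite Lk|apply: bet; lia].
Qed.

Lemma glide_exists x : row_match n t -> 0 < x <= n -> hasR (t x.-1) ->
  (x < n -> t x = ElbowTL) -> exists y, glide n t x y.
Proof.
move=> rm xn Rx tx; have [|y [yx ty bet]] := right_source rm _ Rx; first lia.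
by exists y; split=> // [|z yz]; [lia|apply: bet; lia].
Qed.

Lemma run_exists x : row_match n t -> 0 < n -> x <= n -> (x < n -> hasT (t x)) ->
  exists y, run n t x y.
Proof.
move=> rm n0; rewrite leq_eqVlt => /orP[/eqP->|xn] Tx.
  case: (rm) => _ _ R; case: (glide_exists rm (x := n)) => // [||y]; try lia.
  by exists y; right.
have {Tx} := Tx xn; case tx : (t x) => // _; try by exists x; left; rewrite tx.
case: rm (rm) => edge left _ rm.
have x0 : 0 < x by case: x xn tx left => // _ ->.
case: (glide_exists rm (x := x)) => [|||y] //; first by lia.
  by rewrite edge ?prednK // tx.
by exists y; right.
Qed.

Lemma run_bot x y : run n t x y -> [/\ y <= x, y < n & hasB (t y)].
Proof.
case=> [[<- [xn /andP[_ Bx]]]|[yx ty _ _]]; first by split.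
by rewrite ty; split=> //; lia.
Qed.

Lemma run_top x y : run n t x y -> x < n -> hasT (t x).
Proof. by case=> [[_ [_ /andP[]]]|[_ _ tx _ xn]] //; rewrite tx. Qed.

(** Since [y' < y <= x < x'], column [x] is strictly inside the second segment, while the first pipe
    enters it from the top. *)
Lemma run_cross x y x' y' : run n t x y -> run n t x' y' -> x < x' -> y' < y ->
  x < n /\ t x = Cross.
Proof.
move=> r r' xx' yy'; have [yx _ _] := run_bot r.
case: r' => [[? _]|[x'n _ _ bet]]; first lia.
have xn : x < n by lia.
by split=> //; move: (run_top r xn) (bet x); case: (t x) => //= _; lia.
Qed.

Lemma run_through x y c : run n t x y -> y <= c <= x -> c < n -> t c = Cross ->
  x = c /\ y = c \/ y < c < x.
Proof.
case=> [[<- _]|[yx ty tx bet]] ycx cn tc; [left|right]; first lia.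
have cy : c <> y by move=> e; rewrite -e tc in ty.
have cx : c <> x by move=> e; move: tx; rewrite -e tc => /(_ cn).
lia.
Qed.

Lemma run_glide x y : run n t x y -> y < x -> glide n t x y.
Proof. by case=> // -[-> _]; rewrite ltnn. Qed.

(** The elbow at [x] has no right edge, so it is not inside the other segment, and it differs from
    the elbow at [y']. *)
Lemma glide_separate x y x' y' : glide n t x y -> glide n t x' y' -> x < x' -> x < y'.
Proof.
case=> yx ty tx b [yx' ty' tx' b'] lt; rewrite ltnNge leq_eqVlt; apply/negP => /orP[/eqP e|lt'].
  by move: tx; rewrite -e ty' => h; suff /h : y' < n by []; lia.
by have := b' x; rewrite tx ?lt' ?lt //; [move/(_ isT)|lia].
Qed.

Lemma run_inj x x' y : run n t x y -> run n t x' y -> x = x'.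
Proof.
case=> [h|g] [h'|g'].
- by case: h h' => -> _ [].
- by case: h g' => -> [_ h] [_ e _ _]; rewrite e in h.
- by case: h' g => -> [_ h] [_ e _ _]; rewrite e in h.
case: (g) (g') => yx _ _ _ [yx' _ _ _].
case: (ltngtP x x') => // lt.
  by have := glide_separate g g' lt; lia.
by have := glide_separate g' g lt; lia.
Qed.

End Run.

(** * The cells visited by a pipe *)

Definition goes_down (t : tile) (top : bool) :=
  if top then hasT t && hasB t else t == ElbowRB.
Definition goes_left (t : tile) (top : bool) :=
  if top then t == ElbowTL else hasL t && hasR t.

(** The graph of [walk], without fuel, on the walks that leave through the bottom; [wk_walk] leads
    back to [walk]. *)
Inductive wk (T : nat -> nat -> tile) (k : nat) :
    nat -> nat -> bool -> seq (nat * nat * bool) -> nat -> Prop :=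
  | wk_exit r c top : goes_down (T r c) top -> r.+1 = k -> wk T k r c top [:: (r, c, ~~ top)] c
  | wk_down r c top l e : goes_down (T r c) top -> r.+1 <> k -> wk T k r.+1 c true l e ->
      wk T k r c top ((r, c, ~~ top) :: l) e
  | wk_left r c top l e : goes_left (T r c.+1) top -> wk T k r c false l e ->
      wk T k r c.+1 top ((r, c.+1, ~~ top) :: l) e.

Definition cells_of (l : seq (nat * nat * bool)) := [seq (x.1.1, x.1.2) | x <- l].

Section Walk.
Variable T : nat -> nat -> tile.

Lemma wk_walk k r c top l e f : wk T k r c top l e -> size l <= f ->
  walk T k f r c top = (l, Some e).
Proof.
move=> h; elim: h f => {r c top l e}
  [r c top|r c top l e|r c top l e] down; [move=> <-|move=> rk _ IH|move=> _ IH];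
  case=> // f /= sz; move: down.
- by case: top; case: (T r c) => //= _; rewrite eqxx.
- by case: top; case: (T r c) => //= _; rewrite ifN ?IH //; apply/eqP.
- by case: top; case: (T r c.+1) => //= _; rewrite IH.
Qed.

(** Every cell but the last is left downwards to a new row or leftwards to a new column. This bounds
    the length by the fuel of [pipe]. *)
Lemma wk_size k r c top l e : wk T k r c top l e -> r < k -> size l + e = k - r + c.
Proof.
elim=> {r c top l e} [r c top _ <- _|r c top l e _ rk _ IH lt|r c top l e _ _ IH lt] /=.
- by lia.
- by rewrite addSn IH; lia.
- by rewrite addSn IH; lia.
Qed.

(** With one more row the final [wk_exit] becomes a [wk_down], after which the second walk takes
    over. *)
Lemma wk_cat k r c top l e l' e' : wk T k r c top l e -> r < k ->
  wk T k.+1 k e true l' e' -> wk T k.+1 r c top (l ++ l') e'.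
Proof.
elim=> {r c top l e} [r c top d <- _ h|r c top l e d rk _ IH lt h|r c top l e d _ IH lt h] /=.
- by apply: wk_down => //; lia.
- by apply: wk_down => //; [lia|apply: IH => //; lia].
- by apply: wk_left => //; apply: IH.
Qed.

Lemma wk_glide r y k : y <= k -> T r y = ElbowRB ->
  (forall z, y < z <= k -> hasL (T r z) && hasR (T r z)) ->
  exists l, [/\ wk T r.+1 r k false l y, uniq (cells_of l) &
    forall s c : nat, ((s, c) \in cells_of l) = (s == r) && (y <= c <= k)].
Proof.
move=> yk ty; elim: k yk => [|k IH] yk bet.
  have y0 : y = 0 by lia.
  subst y; exists [:: (r, 0, true)]; split=> //; first by apply: wk_exit; rewrite //= ty.
  by move=> s c; rewrite mem_seq1 xpair_eqE /=; lia.
case: (y =P k.+1) => [e|ne].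
  subst y; exists [:: (r, k.+1, true)]; split=> //; first by apply: wk_exit; rewrite //= ty.
  by move=> s c; rewrite mem_seq1 xpair_eqE /=; lia.
have [|z zk|l [wl ul ml]] := IH; [lia|by apply: bet; lia|].
exists ((r, k.+1, true) :: l); split.
- by apply: (@wk_left _ _ _ _ false) => //=; apply: bet; lia.
- by rewrite /= ul andbT ml; lia.
- by move=> s c; rewrite inE ml xpair_eqE /=; lia.
Qed.

(** The start [minn x n.-1] with flag [x < n] means column [x] from the top, or, for [x = n], column
    [n.-1] from the right. *)
Lemma wk_run n r x y : run n (T r) x y ->
  exists l, [/\ wk T r.+1 r (minn x n.-1) (x < n) l y, uniq (cells_of l) &
    forall s c : nat, ((s, c) \in cells_of l) = (s == r) && (y <= c <= x) && (c < n)].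
Proof.
case=> [[<- [xn TB]]|[yx ty tx bet]].
  exists [:: (r, x, ~~ true)]; split=> //; last by move=> s c; rewrite mem_seq1 xpair_eqE /=; lia.
  by rewrite xn (_ : minn x _ = x); [apply: wk_exit|lia].
case: (ltnP x n) => xn.
  have [|z zx|l [wl ul ml]] := @wk_glide r y x.-1 _ ty; [lia|by apply: bet; lia|].
  exists ((r, x, ~~ true) :: l); split.
  - rewrite (_ : minn x _ = x.-1.+1); last by lia.
    have -> : x = x.-1.+1 by lia.
    by apply: wk_left; rewrite //= prednK ?tx //; lia.
  - by rewrite /= ul andbT ml; lia.
  - by move=> s c; rewrite inE ml xpair_eqE /=; lia.
have [|z zx|l [wl ul ml]] := @wk_glide r y n.-1 _ ty; [lia|by apply: bet; lia|].
exists l; split=> //; first by rewrite (_ : minn x _ = n.-1) //; lia.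
by move=> s c; rewrite ml; lia.
Qed.

Lemma wk_trajectory n k i (e : nat -> nat) : i < k -> e i = n ->
  (forall r, i <= r < k -> run n (T r) (e r) (e r.+1)) ->
  exists l, [/\ wk T k i n.-1 false l (e k), uniq (cells_of l) &
    forall s c : nat, ((s, c) \in cells_of l) = (i <= s < k) && (e s.+1 <= c <= e s) && (c < n)].
Proof.
move=> + ei; elim: k => // k IH ik R.
have [l [wl ul ml]] := wk_run (R k ltac:(lia)).
case: (i =P k) => [e0|ne].
  subst k; exists l; split=> //; first by move: wl; rewrite ei ltnn (_ : minn n _ = n.-1) //; lia.
  move=> s c; rewrite ml; case: (s =P i) => [->|si]; last by lia.
  by rewrite leqnn ltnSn.
have [|r rk|l' [wl' ul' ml']] := IH; [lia|by apply: R; lia|].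
have ekn : e k < n.
  by have [] := run_bot (R k.-1 ltac:(lia)); rewrite prednK //; lia.
exists (l' ++ l); split.
- apply: (wk_cat wl'); first lia.
  by move: wl; rewrite ekn (_ : minn _ _ = e k) //; lia.
- rewrite /cells_of map_cat cat_uniq -/(cells_of l) -/(cells_of l') ul ul' andbT /=.
  by apply/hasPn => -[s c]; rewrite ml ml'; lia.
move=> s c; rewrite /cells_of map_cat mem_cat -/(cells_of l) -/(cells_of l') ml ml'.
case: (s =P k) => [->|sk]; lia.
Qed.

End Walk.

Lemma pipe_trajectory n (D : grid n) k i (e : nat -> nat) : i < k -> e i = n ->
  (forall r, i <= r < k -> run n (tileAt D r) (e r) (e r.+1)) ->
  [/\ exit_col D k i = Some (e k), uniq (pipe_cells D k i) &
    forall s c : nat, ((s, c) \in pipe_cells D k i) =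
      (i <= s < k) && (e s.+1 <= c <= e s) && (c < n)].
Proof.
move=> ik ei R; have [l [wl ul ml]] := wk_trajectory ik ei R.
have sz := wk_size wl ik.
have := wk_walk wl (f := (k + n).+1); rewrite /exit_col /pipe_cells /pipe => -> //=.
lia.
Qed.

(** * Extending partial injections to permutations *)

Lemma perm_extend n k (f : 'I_n -> 'I_n) :
  (forall i j : 'I_n, i < k -> j < k -> f i = f j -> i = j) ->
  exists u : 'S_n, forall i : 'I_n, i < k -> u i = f i.
Proof.
elim: k => [|k IH] inj; first by exists 1%g.
have [|u uf] := IH; first by move=> i j ik jk; apply: inj; apply: ltnW.
case: (ltnP k n) => kn; last by exists u => i _; apply: uf; apply: leq_trans (ltn_ord i) kn.
pose x := Ordinal kn; pose y := (u^-1 (f x))%g; have ey : u y = f x by rewrite permKV.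
have ky : k <= y.
  rewrite leqNgt; apply/negP => yk; have := uf y yk; rewrite ey => e.
  have exy : x = y by apply: inj => //; rewrite ltnS ?leqnn ltnW.
  by have : nat_of_ord x = y; [rewrite exy|rewrite /=; lia].
exists (tperm x y * u)%g => i; rewrite permM ltnS leq_eqVlt => /orP[/eqP e|ik].
  have -> : i = x by apply: val_inj; rewrite /= e.
  by rewrite tpermL.
by rewrite tpermDn ?uf //=; lia.
Qed.

(** Take an extension of maximal length: exchanging a non-inversion at positions from [k] on would
    keep the first [k] values and increase the length. *)
Lemma desc_extend n k (f : 'I_n -> 'I_n) :
  (forall i j : 'I_n, i < k -> j < k -> f i = f j -> i = j) ->
  exists u : 'S_n, desc k u /\ forall i : 'I_n, i < k -> u i = f i.
Proof.
move=> /perm_extend[u0 uf0].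
pose P (u : 'S_n) := [forall i : 'I_n, (i < k) ==> (u i == f i)].
have PP (u : 'S_n) : reflect (forall i : 'I_n, i < k -> u i = f i) (P u).
  by apply: (iffP forallP) => [h i ik|h i]; [apply/eqP; apply: (implyP (h i))|apply/implyP => /h->].
have P0 : P u0 by apply/PP.
have Pbound (u : 'S_n) : P u -> len u <= #|{: 'I_n * 'I_n}| by move=> _; apply: max_card.
have bound : exists M, forall u : 'S_n, P u -> len u <= M by exists #|{: 'I_n * 'I_n}|.
case: (arg_maxnP (@len n) P0) => u /PP Pu umax.
exists u; split=> // i j ki ij; rewrite ltnNge leq_eqVlt; apply/negP => /orP[/eqP/perm_val_inj e|lt].
  by rewrite e ltnn in ij.
pose v := (tperm i j * u)%g.
have ve x : v x = u (tperm i j x) by rewrite permM.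
have Pv : P v.
  by apply/PP => x xk; rewrite ve tpermDn ?Pu //; lia.
have : len v <= len u := umax v Pv.
rewrite (len_tperm ij lt ve) -{2}[len u]addn0 leq_add2l leqn0 cards_eq0.
move=> /eqP/setP/(_ (i, j)); rewrite !inE /= !ve !tpermL !tpermR ij lt /=; lia.
Qed.

Lemma desc_w0 n : desc 0 (w0 n).
Proof. by move=> i j _ ij; rewrite !permE /=; have := ltn_ord j; lia. Qed.

(** * Permutations between the rows of a matching grid *)

Section Flow.
Variables (n : nat) (T : nat -> nat -> tile).

(** This tracks the pipes row by row instead of by walks: [U m] holds their columns above row [m],
    and [entry] accounts for pipe [m], which joins in that row. By [flow_u_k] it computes [u_k]. *)
Record flow (k : nat) (U : nat -> 'S_n) : Prop := Flow {
  flow_run : forall m (i : 'I_n), m < k -> i <= m ->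
    run n (T m) (entry m (U m) i) (U m.+1 i);
  flow_desc : forall m, m <= k -> desc m (U m) }.

Definition matching : Prop :=
  [/\ (forall r c, r < n -> c.+1 < n -> hasR (T r c) = hasL (T r c.+1)),
      (forall r c, r.+1 < n -> c < n -> hasB (T r c) = hasT (T r.+1 c)),
      (forall r, r < n -> ~~ hasL (T r 0)),
      (forall c, c < n -> ~~ hasT (T 0 c)) &
      (forall r, r < n -> hasR (T r n.-1))].

Lemma matching_row m : matching -> m < n -> row_match n (T m).
Proof. by case=> h _ l _ r mn; split; [move=> c; apply: h|apply: l|apply: r]. Qed.

Lemma flow_top k U m (i : 'I_n) : matching -> flow k U -> m <= k -> m < n -> i < m ->
  hasT (T m (U m i)).
Proof.
case=> _ vert _ _ _ F; case: m => // m mk mn im.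
by rewrite -vert //; have [] := run_bot (flow_run F mk im).
Qed.

(** By [run_inj] the exits of a row are distinct, so [desc_extend] completes them to the next
    permutation; the construction starts from [w0]. *)
Lemma flow_exists : 0 < n -> matching -> exists U, flow n U.
Proof.
move=> n0 M; suff H k : k <= n -> exists U, flow k U by apply: H.
elim: k => [|k IH] kn.
  by exists (fun=> w0 n); split=> // m; rewrite leqn0 => /eqP->; apply: desc_w0.
have [U F] := IH (ltnW kn).
have [f fP] : exists f : 'I_n -> 'I_n, forall i : 'I_n, i <= k ->
    run n (T k) (entry k (U k) i) (f i).
  apply: (fin_all_exists (P := fun (i y : 'I_n) => i <= k -> run n (T k) (entry k (U k) i) y)) => i.
  case: (leqP i k) => ik; last by exists i.
  have [||y ry] := @run_exists n (T k) (entry k (U k) i) (matching_row M kn) n0.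
  - by rewrite /entry; case: ifP => // _; apply: ltnW.
  - case: (nat_of_ord i =P k) => [/entry_eq->|ne _]; first by rewrite ltnn.
    by rewrite entry_ne //; apply: (flow_top M F) => //; lia.
  by have [_ yn _] := run_bot ry; exists (Ordinal yn).
have [|u [du uf]] := @desc_extend n k.+1 f.
  move=> i j ik jk e; have := fP j jk; rewrite -e => /(run_inj (fP i ik)).
  case: (nat_of_ord i =P k) => ei; case: (nat_of_ord j =P k) => ej.
  - by move=> _; apply: val_inj; rewrite /= ei ej.
  - by rewrite (entry_eq _ ei) (entry_ne _ ej) => h; have := ltn_ord (U k j); lia.
  - by rewrite (entry_eq _ ej) (entry_ne _ ei) => h; have := ltn_ord (U k i); lia.
  - by rewrite (entry_ne _ ej) (entry_ne _ ei) => /perm_val_inj.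
exists (fun m => if m == k.+1 then u else U m); split=> m.
  move=> i mk im; rewrite ifN; last by lia.
  rewrite eqSS; case: (m =P k) => [?|mk']; last by apply: (flow_run F) => //; lia.
  by subst m; rewrite uf //; apply: fP.
case: (m =P k.+1) => [-> //|ne] mk; apply: (flow_desc F); lia.
Qed.

Section Full.
Variable U : nat -> 'S_n.
Hypotheses (M : matching) (F : flow n U).

(** The point is that every segment belongs to a tracked pipe. Below the last row all [n] columns
    are exits of tracked pipes. If this holds for the bottom edges of a row, it holds for the top
    edges: a run from the top ends where a tracked one does, and [run_inj] identifies the two. *)
Lemma flow_occupied m (c : 'I_n) : m < n ->
  hasT (T m c) = ((U m)^-1%g c < m) /\ hasB (T m c) = ((U m.+1)^-1%g c <= m).
Proof.
case: (M) => _ vert _ top _ mn.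
have n0 : 0 < n by apply: leq_ltn_trans mn.
have botT m' (x : 'I_n) : m' < n -> (U m'.+1)^-1%g x <= m' -> hasB (T m' x).
  move=> mn' xm; have := flow_run F mn' xm; rewrite permKV => /run_bot[] //.
have topT m' (x : 'I_n) : m' < n -> (U m')^-1%g x < m' -> hasT (T m' x).
  by move=> mn' xm; have := flow_top M F (ltnW mn') mn' xm; rewrite permKV.
have Ttop m' : m' < n -> (forall x : 'I_n, hasB (T m' x) -> (U m'.+1)^-1%g x <= m') ->
    forall x : 'I_n, hasT (T m' x) -> (U m')^-1%g x < m'.
  move=> mn' hB x hT.
  have [|y ry] := run_exists (matching_row M mn') n0 (ltnW (ltn_ord x)); first by [].
  have [_ yn By] := run_bot ry; have := hB (Ordinal yn) By.
  set i := (U m'.+1)^-1%g _ => im; have := flow_run F mn' im; rewrite permKV => /(run_inj ry) e.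
  case: (nat_of_ord i =P m') => ei; first by move: e; rewrite entry_eq //; have := ltn_ord x; lia.
  have -> : x = U m' i by apply: val_inj; rewrite /= e entry_ne.
  by rewrite permK; lia.
(* Here [d] is the number of rows below [m'], so the induction climbs from the last row. *)
have Bbot d : forall m', n = (m' + d).+1 -> forall x : 'I_n, hasB (T m' x) -> (U m'.+1)^-1%g x <= m'.
  elim: d => [|d IH] m' e x; first by have := ltn_ord ((U m'.+1)^-1%g x); lia.
  rewrite vert; [|lia|by []] => /Ttop; rewrite ltnS; apply; first lia.
  by apply: IH; lia.
have {}Bbot m' : m' < n -> forall x : 'I_n, hasB (T m' x) -> (U m'.+1)^-1%g x <= m'.
  by move=> mn'; apply: (Bbot (n - m'.+1)); lia.
split; apply/idP/idP.
- by apply: Ttop => //; apply: Bbot.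
- exact: topT.
- exact: Bbot.
- exact: botT.
Qed.

(** The source elbow to the left of a used right edge is the exit of a tracked pipe [p]. Its entry
    lies right of [c], since an [ElbowTL] cannot occur inside the segment. *)
Lemma flow_right m (c : 'I_n) : m < n ->
  hasR (T m c) = [exists p : 'I_n, (p <= m) && (U m.+1 p <= c < entry m (U m) p)].
Proof.
move=> mn; apply/idP/existsP => [Rc|[p /andP[pm /andP[pc cp]]]].
  have [y [yc ty bet]] := right_source (matching_row M mn) (ltn_ord c) Rc.
  have yn : y < n by apply: leq_ltn_trans yc (ltn_ord c).
  have [_] := flow_occupied (Ordinal yn) mn; rewrite /= ty /=.
  set p := (U m.+1)^-1%g _ => /esym pm; exists p; rewrite pm /=.
  have := flow_run F mn pm; rewrite permKV /= yc => -[[e [_ /andP[]]]|[ye _ te _]].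
    by rewrite e ty.
  rewrite ltnNge; apply/negP => ec.
  have en : entry m (U m) p < n by apply: leq_ltn_trans ec (ltn_ord c).
  by move: (bet (entry m (U m) p)); rewrite te // => /(_ ltac:(lia)).
have [e|[_ ty _ bet]] := flow_run F mn pm; first by case: e; lia.
case: (nat_of_ord c =P U m.+1 p) => [->|ne]; first by rewrite ty.
by have /andP[] : hasL (T m c) && hasR (T m c) by apply: bet; lia.
Qed.

End Full.
End Flow.

(** * Crossings of two pipes *)

Lemma count_gt1 (A : eqType) (P : pred A) (l : seq A) x y :
  x \in l -> y \in l -> P x -> P y -> x != y -> 1 < count P l.
Proof.
move=> xl yl Px Py xy; rewrite -size_filter.
apply: (@uniq_leq_size _ [:: x; y]); first by rewrite /= inE xy.
by move=> z; rewrite !inE mem_filter => /orP[]/eqP->; apply/andP.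
Qed.

Lemma count_le1 (A : eqType) (P : pred A) (l : seq A) : uniq l ->
  (forall x y, x \in l -> y \in l -> P x -> P y -> x = y) -> count P l <= 1.
Proof.
move=> ul uq; rewrite -size_filter.
have := filter_uniq P ul; have : {subset filter P l <= filter P l} by [].
case: {1 3 4}(filter P l) => [|x [|y r]] // sub /andP[].
have /andP[Px xl] : P x && (x \in l) by rewrite -mem_filter sub // inE eqxx.
have /andP[Py yl] : P y && (y \in l) by rewrite -mem_filter sub // !inE eqxx orbT.
by rewrite (uq x y) // inE eqxx.
Qed.

(** To restore the order, [p] would have to pass over the later pipe [q]: [row_disjoint] forbids
    this if [q] moves, [row_cross] if it stays. *)
Lemma row_inversion n m (u v : 'S_n) (p q : 'I_n) : row_step m u v -> p < q -> q < m ->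
  v q < v p -> u q < u p.
Proof.
move=> R pq qm vqp; have pm : p <= m by lia.
have ne : u p <> u q :> nat by move/perm_val_inj => e; rewrite e ltnn in pq.
rewrite ltnNge; apply/negP => le; have leq' := row_le R (ltnW qm).
case: (ltngtP (u q) (v q)) leq' => // [lt|e] _.
  by have := row_disjoint R pm (ltnW qm); lia.
by have := row_cross R pm (ltnW qm); lia.
Qed.

Section Crossings.
Variables (n : nat) (D : grid n) (U : nat -> 'S_n).
Hypothesis F : flow (tileAt D) n U.

Lemma flow_pipe k (i : 'I_n) : k <= n -> i < k ->
  [/\ exit_col D k i = Some (val (U k i)), uniq (pipe_cells D k i) &
    forall s c : nat, ((s, c) \in pipe_cells D k i) =
      (i <= s < k) && (U s.+1 i <= c <= entry s (U s) i) && (c < n)].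
Proof.
move=> kn ik; have en r : i <= r -> entry r.+1 (U r.+1) i = U r.+1 i.
  by move=> ir; rewrite entry_ne //; lia.
have [||ex un me] := @pipe_trajectory n D k i (fun r => entry r (U r) i) ik.
- by rewrite entry_eq.
- by move=> r ir; rewrite en; [apply: (flow_run F); lia|lia].
split=> // [|s c].
  by rewrite ex -(prednK (leq_ltn_trans (leq0n i) ik)) en //; lia.
by rewrite me; case: (leqP i s) => //= is'; rewrite en.
Qed.

Lemma flow_assoc k : k <= n -> assoc_k D k (U k).
Proof.
move=> kn; apply/andP; split; apply/forallP => i.
  by apply/implyP => ik; have [-> _ _] := flow_pipe kn ik.
by apply/forallP => j; apply/implyP => /andP[ki ij]; apply: (flow_desc F kn).
Qed.

Lemma assoc_desc k u : assoc_k D k u -> desc k u.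
Proof. by case/andP => _ /forallP h i j ki ij; move/forallP/(_ j)/implyP: (h i); apply; rewrite ki. Qed.

Lemma assoc_uniq k u v : assoc_k D k u -> assoc_k D k v -> u = v.
Proof.
move=> au av; apply: (desc_uniq (assoc_desc au) (assoc_desc av)) => i ik.
case/andP: au => /forallP/(_ i); rewrite ik => /eqP eu _.
case/andP: av => /forallP/(_ i); rewrite ik => /eqP ev _.
by apply: val_inj; move: eu; rewrite ev => -[].
Qed.

Lemma flow_u_k k : k <= n -> u_k D k = U k.
Proof.
move=> kn; rewrite /u_k; case: pickP => [u au|/(_ (U k))]; last by rewrite flow_assoc.
exact: assoc_uniq au (flow_assoc kn).
Qed.

(* Pipe q enters at the right of pipe p < q, so q starts out on the right and
   the pipes cross exactly in the rows in which their order is exchanged.  A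
   violation of [row_cross] would be a second such exchange. *)
Lemma row_of_flow m : (forall i j, i < j < n -> crossings D i j <= 1) -> m < n ->
  row_step m (U m.+1) (U m).
Proof.
move=> cr mn; have Rn (i : 'I_n) := flow_run F (i := i) mn.
have ltne (u : 'S_n) (p q : 'I_n) : p < q -> u p <> u q :> nat.
  by move=> pq /perm_val_inj e; rewrite e ltnn in pq.
(* An exchange in an earlier row [r] yields a crossing in column [entry r (U r) p] by [run_cross],
   in addition to the one at [(m, c)]. *)
have noexch r (p q : 'I_n) : p < q -> q <= r -> r < m ->
    entry r (U r) p < entry r (U r) q -> U r.+1 q < U r.+1 p ->
    forall c, (m, c) \in pipe_cells D n p -> (m, c) \in pipe_cells D n q ->
    tileAt D m c = Cross -> False.
  move=> pq qr rm lt gt c cp cq tc.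
  have rn : r < n by lia.
  have pr : p <= r by lia.
  have rp := flow_run F rn pr; have rq := flow_run F rn qr.
  have [en te] := run_cross rp rq lt gt.
  have [yx _ _] := run_bot rp.
  set d := entry r (U r) p in en te lt yx.
  have [_ _ mp] := flow_pipe (leqnn n) (ltn_ord p).
  have [_ _ mq] := flow_pipe (leqnn n) (ltn_ord q).
  have := cr p q; rewrite pq ltn_ord => /(_ isT); rewrite leqNgt => /negP; apply.
  apply: (count_gt1 (x := (r, d)) (y := (m, c))) => //=.
  - by rewrite mp -/d; lia.
  - by rewrite mq te eqxx; lia.
  - by rewrite cq tc eqxx.
  - by rewrite xpair_eqE; lia.
have order (p q : 'I_n) c : p < q -> q <= m -> 
    (m, c) \in pipe_cells D n p -> (m, c) \in pipe_cells D n q ->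
    tileAt D m c = Cross -> entry m (U m) p < entry m (U m) q.
  move=> pq qm cp cq tc.
  have qn := ltn_ord q.
  suff H d : q + d <= m -> entry (q + d) (U (q + d)) p < entry (q + d) (U (q + d)) q.
    by have := H (m - q); rewrite subnKC //; apply.
  elim: d => [|d IH] dm; first by rewrite addn0 (entry_eq _ (erefl _)) entry_ne //; lia.
  rewrite addnS !entry_ne; try lia.
  have {}IH := IH ltac:(lia).
  case: (ltngtP (U (q + d).+1 p) (U (q + d).+1 q)) => // [gt|e]; last by case: (ltne _ _ _ pq e).
  by exfalso; apply: (noexch (q + d) p q) tc => //; lia.
split; [| | |exact: (flow_desc F (ltnW mn))|exact: (flow_desc F mn)].
- move=> q qm; have [le _ _] := run_bot (Rn q qm).
  case: (nat_of_ord q =P m) => e; last by rewrite entry_ne in le.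
  rewrite leqNgt; apply/negP => lt.
  (* Pipe [m] enters from the boundary, so its exit must be compared with [U m q] indirectly. If
     position [y] holds the exit column above the row, [y < m] puts a pipe onto an [ElbowRB], and
     [y > m] violates the descents of [U m]. *)
  pose y := ((U m)^-1%g (U m.+1 q)); have ey : U m y = U m.+1 q by rewrite permKV.
  case: (ltngtP y m) => ym.
  - have := Rn q qm; rewrite (entry_eq _ e) => -[[eq _]|[_ ty _ _]].
      by have := ltn_ord (U m.+1 q); lia.
    have := Rn y (ltnW ym); rewrite entry_ne ?ey; last lia.
    by move/run_top; rewrite ty => /(_ (ltn_ord _)).
  - have := flow_desc F (ltnW mn) (i := q) (j := y); rewrite ey e leqnn => /(_ isT ym); lia.
  - have eyq : y = q by apply: val_inj; rewrite /= ym e.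
    by rewrite -ey eyq ltnn in lt.
- move=> p q pm qm up uq pq.
  have pe : U m.+1 p < entry m (U m) p by rewrite /entry; case: ifP.
  have qe : U m.+1 q < entry m (U m) q by rewrite /entry; case: ifP.
  have gp := run_glide (Rn p pm) pe; have gq := run_glide (Rn q qm) qe.
  have vpe : U m p <= entry m (U m) p by rewrite /entry; case: ifP => // _; apply: ltnW.
  have vqe : U m q <= entry m (U m) q by rewrite /entry; case: ifP => // _; apply: ltnW.
  case: (ltngtP (entry m (U m) p) (entry m (U m) q)) => [lt|lt|e].
  - by left; have := glide_separate gp gq lt; lia.
  - by right; have := glide_separate gq gp lt; lia.
  move: e; case: (nat_of_ord p =P m) => ep; case: (nat_of_ord q =P m) => eq'.
  + by lia.
  + by rewrite (entry_eq _ ep) (entry_ne _ eq') => h; have := ltn_ord (U m q); lia.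
  + by rewrite (entry_eq _ eq') (entry_ne _ ep) => h; have := ltn_ord (U m p); lia.
  + by rewrite (entry_ne _ ep) (entry_ne _ eq') => /perm_val_inj h; rewrite h in pq.
move=> p q pm qm b e; rewrite ltnNge; apply/negP => pq.
have {}pq : p < q.
  by rewrite ltn_neqAle pq andbT; apply/eqP => /val_inj h; rewrite h in b; lia.
have pm' : p <> m :> nat by lia.
have pe : U m.+1 p < entry m (U m) p by rewrite entry_ne //; lia.
have [_ _ _ bet] := run_glide (Rn p pm) pe.
have tLR : hasL (tileAt D m (U m.+1 q)) && hasR (tileAt D m (U m.+1 q)).
  by apply: bet; rewrite entry_ne.
have rq := Rn q qm.
have [_ _ mp] := flow_pipe (leqnn n) (ltn_ord p).
have [_ _ mq] := flow_pipe (leqnn n) (ltn_ord q).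
case: (nat_of_ord q =P m) => eqm.
  have [h|[_ ty _ _]] := rq; first by case: h; rewrite entry_eq // => h; have := ltn_ord (U m.+1 q); lia.
  by rewrite ty in tLR.
(* The stationary pipe [q] enters this tile from the top and the segment of [p] runs through it. *)
have tc : tileAt D m (U m.+1 q) = Cross.
  have := run_top rq; rewrite entry_ne // -e => /(_ (ltn_ord _)); move: tLR.
  by case: (tileAt _ _ _).
have h := order p q (U m.+1 q) pq qm; rewrite mp mq !entry_ne // -e in h.
have lt := ltn_ord (U m.+1 q).
by have := h ltac:(lia) ltac:(lia) tc; lia.
Qed.

(** By [key] a crossing exchanges the order of the two pipes, and [row_inversion] keeps it
    exchanged, so all crossings lie in one row. There the column is that of the earlier pipe. *)
Lemma crossings_le1 : (forall m, m < n -> row_step m (U m.+1) (U m)) ->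
  forall i j, i < j < n -> crossings D i j <= 1.
Proof.
move=> R i j /andP[ij jn]; pose p := Ordinal (ltn_trans ij jn); pose q := Ordinal jn.
have pq : p < q by [].
rewrite -[i]/(val p) -[j]/(val q); move: p q pq => p q pq {i j ij jn}.
have [_ up mp] := flow_pipe (leqnn n) (ltn_ord p).
have [_ uq mq] := flow_pipe (leqnn n) (ltn_ord q).
have key (s c : nat) : (s, c) \in pipe_cells D n p -> (s, c) \in pipe_cells D n q ->
    tileAt D s c = Cross ->
    [/\ q <= s < n, U s p = c :> nat, U s p < entry s (U s) q & U s.+1 q < U s.+1 p].
  rewrite mp mq => cp cq tc.
  have sn : s < n by lia.
  have qs : q <= s by lia.
  have ps : p <= s by lia.
  have ep : entry s (U s) p = U s p by rewrite entry_ne //; lia.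
  have ltc : c < n by lia.
  have rp := flow_run F sn ps; have rq := flow_run F sn qs.
  have cp' : U s.+1 p <= c <= entry s (U s) p by lia.
  have cq' : U s.+1 q <= c <= entry s (U s) q by lia.
  (* Each pipe is vertical or horizontal at the crossing. Only [p] vertical and [q] horizontal
     survives: two vertical pipes would coincide, [row_cross] excludes the opposite roles, and
     disjointness two horizontal ones. *)
  case: (run_through rp cp' ltc tc) (run_through rq cq' ltc tc) => [[xp yp]|hp] [[xq yq]|hq].
  - by have : U s.+1 p = U s.+1 q :> nat; [lia|move/perm_val_inj => e; rewrite e ltnn in pq].
  - by split=> //; lia.
  - have qs' : q <> s :> nat by move=> e; move: xq; rewrite entry_eq //; lia.
    have := row_cross (R _ sn) ps qs; move: xq; rewrite entry_ne //; lia.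
  - have := row_disjoint_entry (R _ sn) ps qs; lia.
have later s s' : U s.+1 q < U s.+1 p -> q <= s -> s < s' -> s' < n -> U s' q < U s' p.
  move=> lt qs; elim: s' => // s' IH; rewrite ltnS leq_eqVlt => /orP[/eqP<-//|ss'] sn.
  by apply: (row_inversion (R s' (ltnW sn)) pq); [lia|apply: IH => //; apply: ltnW].
apply: count_le1 => // -[s c] [s' c'] cp cp' /= /andP[cq /eqP tc] /andP[cq' /eqP tc'].
have [qs es ls gs] := key _ _ cp cq tc; have [qs' es' ls' gs'] := key _ _ cp' cq' tc'.
case: (ltngtP s s') => ss'; last by subst s'; rewrite -es -es'.
  have := later s s' gs; rewrite entry_ne in ls'; lia.
have := later s' s gs'; rewrite entry_ne in ls; lia.
Qed.

End Crossings.

(** * The grid of a chain *)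

Lemma tile_ext t t' : hasT t = hasT t' -> hasB t = hasB t' -> hasR t = hasR t' -> t = t'.
Proof. by case: t; case: t'. Qed.

(** For elbows the top and bottom edges fix the tile; [grid_right] proves that its right edge is the
    prescribed one. *)
Definition tile_of (top bot right : bool) : tile :=
  match top, bot, right with
  | true, true, true => Cross
  | true, true, false => Vert
  | true, false, _ => ElbowTL
  | false, true, _ => ElbowRB
  | false, false, true => Horiz
  | false, false, false => Blank
  end.

(** The condition that [flow_right] finds for the right edge of column [c]. *)
Definition covers n m (u v : 'S_n) (c : nat) : bool :=
  [exists p : 'I_n, (p <= m) && (u p <= c < entry m v p)].

Definition grid_of n (U : nat -> 'S_n) : grid n :=
  [ffun x : 'I_n * 'I_n => tile_of ((U x.1)^-1%g x.2 < x.1) ((U x.1.+1)^-1%g x.2 <= x.1)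
                     (covers x.1 (U x.1.+1) (U x.1) x.2)].

Lemma tileAtE n (D : grid n) (r c : 'I_n) : tileAt D r c = D (r, c).
Proof. by rewrite /tileAt !valK. Qed.

Section GridOf.
Variables (n : nat) (U : nat -> 'S_n).
Hypothesis R : forall m, m < n -> row_step m (U m.+1) (U m).
Local Notation T := (tileAt (grid_of U)).

Section Row.
Variable m : nat.
Hypothesis mn : m < n.
Local Notation u := (U m.+1).
Local Notation v := (U m).
Implicit Types c p : 'I_n.

Lemma grid_tile c : T m c = tile_of (v^-1%g c < m) (u^-1%g c <= m) (covers m u v c).
Proof. by have := tileAtE (grid_of U) (Ordinal mn) c; rewrite ffunE. Qed.

Lemma grid_top c : hasT (T m c) = (v^-1%g c < m).
Proof. by rewrite grid_tile; case: (v^-1%g c < m); case: (u^-1%g c <= m); case: (covers m u v c). Qed.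

Lemma grid_bot c : hasB (T m c) = (u^-1%g c <= m).
Proof. by rewrite grid_tile; case: (v^-1%g c < m); case: (u^-1%g c <= m); case: (covers m u v c). Qed.

(** Disjointness makes the edges of a cell consistent: [covered_bot] excludes top and right without
    bottom, [bot_covered] excludes bottom without top or right, while this lemma and [between_top]
    control the left edge. *)
Lemma occupied_left c p : v^-1%g c < m -> p <= m -> u p <= c < entry m v p -> u p < c.
Proof.
set i := v^-1%g _ => im pm b; have ei : v i = c by rewrite permKV.
have ei' : v i = c :> nat by rewrite ei.
have := row_le (R mn) (ltnW im); rewrite ei' leq_eqVlt => /orP[/eqP e|lt].
  rewrite ltn_neqAle; apply/andP; split; last by case/andP: b.
  apply/eqP => e'; have ip : i = p by apply: (@perm_val_inj _ u); rewrite e e'.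
  by move: b; rewrite -ip entry_ne ?ei' ?ltnn ?andbF //; lia.
have ene : entry m v i = c by rewrite entry_ne //; lia.
have := row_disjoint_entry (R mn) (ltnW im) pm.
case: (nat_of_ord i =P p) => [/val_inj e|]; last by lia.
by move: b; rewrite -e ene; lia.
Qed.

Lemma covered_bot c p : v^-1%g c < m -> p <= m -> u p <= c < entry m v p -> u^-1%g c <= m.
Proof.
set i := v^-1%g _ => im pm b; have ei : v i = c by rewrite permKV.
have ei' : v i = c :> nat by rewrite ei.
have := row_le (R mn) (ltnW im); rewrite ei' leq_eqVlt => /orP[/eqP/val_inj<-|lt].
  by rewrite permK ltnW.
have ene : entry m v i = c by rewrite entry_ne //; lia.
have := row_disjoint_entry (R mn) (ltnW im) pm.
case: (nat_of_ord i =P p) => [/val_inj e|]; last by lia.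
by move: b; rewrite -e ene; lia.
Qed.

Lemma bot_covered c : u^-1%g c <= m -> ~~ (v^-1%g c < m) ->
  c < entry m v (u^-1%g c).
Proof.
set j := u^-1%g _ => jm nT; have ej : u j = c by rewrite permKV.
have := row_le_entry (R mn) jm; rewrite ej leq_eqVlt => /orP[/eqP e|//].
case: (nat_of_ord j =P m) => jm'; first by rewrite entry_eq // in e; have := ltn_ord c; lia.
rewrite entry_ne // in e; move/val_inj: e => e; move: nT; rewrite e permK; lia.
Qed.

Lemma between_top c p : u^-1%g c <= m -> p <= m -> u p < c < entry m v p -> v^-1%g c < m.
Proof.
move=> jm pm b; apply/negPn/negP => nT; have := bot_covered jm nT.
move: jm; set j := u^-1%g _ => jm lt; have ej : u j = c :> nat by rewrite permKV.
have := row_disjoint_entry (R mn) jm pm.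
case: (nat_of_ord j =P p) => [/val_inj e|]; last by lia.
by move: b; rewrite -e ej; lia.
Qed.

Lemma entry_top c p : p <= m -> entry m v p = c -> v^-1%g c < m.
Proof.
move=> pm; case: (nat_of_ord p =P m) => e; first by rewrite entry_eq //; have := ltn_ord c; lia.
by rewrite entry_ne // => /val_inj<-; rewrite permK; lia.
Qed.

Lemma grid_right c : hasR (T m c) = covers m u v c.
Proof.
rewrite grid_tile; case tT: (v^-1%g c < m); case tB: (u^-1%g c <= m); case tR: (covers m u v c) => //.
- by case/existsP: tR => p /andP[pm b]; rewrite (covered_bot tT pm b) in tB.
- move/existsP: tR; case; exists (u^-1%g c).
  by rewrite tB permKV leqnn bot_covered // tT.
Qed.

(** The right-hand side is [covers] at the preceding column, which gives the matching across
    vertical edges. *)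
Lemma grid_left c : hasL (T m c) = [exists p : 'I_n, (p <= m) && (u p < c <= entry m v p)].
Proof.
have noT p : (v^-1%g c < m) = false -> p <= m -> entry m v p <> c.
  by move=> tT pm /(entry_top pm); rewrite tT.
rewrite grid_tile; case tT: (v^-1%g c < m); case tB: (u^-1%g c <= m); last case tR: (covers m u v c).
- rewrite /tile_of; case tR: (covers m u v c); apply/esym.
    case/existsP: tR => p /andP[pm b]; apply/existsP; exists p.
    by have := occupied_left tT pm b; lia.
  apply/existsP => -[p /andP[pm b]]; move/existsP: tR; case.
  have [lt|e] : c < entry m v p \/ entry m v p = c by lia.
    by exists p; lia.
  have pm' : p <> m :> nat by move=> h; move: e; rewrite entry_eq //; have := ltn_ord c; lia.
  have vp : v p = c by apply: val_inj; rewrite /= -e entry_ne.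
  exists (u^-1%g c); rewrite tB permKV leqnn /=.
  have := row_le_entry (R mn) tB; rewrite permKV leq_eqVlt => /orP[/eqP h|//].
  have jm : nat_of_ord (u^-1%g c) <> m.
    by move=> h'; move: h; rewrite entry_eq //; have := ltn_ord c; lia.
  rewrite entry_ne // in h; move/val_inj: h => h.
  have : p = u^-1%g c by apply: (@perm_inj _ v); rewrite vp.
  by move=> hp; move: b; rewrite hp permKV ltnn.
- apply/esym/existsP; exists (v^-1%g c); rewrite (ltnW tT) entry_ne; last by lia.
  rewrite permKV leqnn andbT /=.
  have := row_le (R mn) (ltnW tT); rewrite permKV leq_eqVlt => /orP[/eqP/val_inj h|//].
  by move: tB; rewrite -{1}h permK ltnW.
- apply/esym/existsP => -[p /andP[pm b]].
  have h := noT p tT pm; suff: false by []; rewrite -tT; apply: (between_top tB pm); lia.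
- case/existsP: tR => p /andP[pm b]; apply/esym/existsP; exists p.
  suff : u p <> c :> nat by lia.
  by move/val_inj => e; move: tB; rewrite -e permK pm.
- apply/esym/existsP => -[p /andP[pm b]]; move/existsP: tR; case; exists p.
  by have := noT p tT pm; lia.
Qed.

Lemma grid_run p : p <= m -> run n (T m) (entry m v p) (u p).
Proof.
move=> pm; have := row_le_entry (R mn) pm; rewrite leq_eqVlt => /orP[/eqP e|lt].
  by left; rewrite -e grid_top grid_bot permK pm ltn_ord (entry_top pm).
right; split.
- by have := ltn_ord (v p); rewrite lt /entry; case: ifP => _; lia.
- rewrite grid_tile permK pm.
  suff -> : (v^-1%g (u p) < m) = false by [].
  apply/negP => tT; have := occupied_left tT pm; rewrite leqnn lt ltnn; by move=> /(_ isT).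
- case: (nat_of_ord p =P m) => [e|ne _]; first by rewrite entry_eq // ltnn.
  rewrite entry_ne // in lt *; rewrite grid_tile permK (_ : p < m); last lia.
  by rewrite leqNgt (row_top_beyond (R mn) pm lt) // permKV.
move=> z b; have zn : z < n.
  case/andP: b => _ /leq_trans; apply.
  by rewrite /entry; case: ifP => // _; apply: ltnW.
have := grid_left (Ordinal zn); have := grid_right (Ordinal zn) => /= -> ->.
by apply/andP; split; apply/existsP; exists p; lia.
Qed.

End Row.

Lemma grid_matching : matching n (tileAt (grid_of U)).
Proof.
split=> [r c rn cn|r c rn cn|r rn|c cn|r rn].
- have := grid_right rn (Ordinal (ltnW cn)); have := grid_left rn (Ordinal cn) => /= -> ->.
  by apply: eq_existsb => p; rewrite ltnS; congr (_ && _); lia.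
- have := grid_bot (ltnW rn) (Ordinal cn); have := grid_top rn (Ordinal cn) => /= -> ->.
  by rewrite ltnS.
- have n0 : 0 < n by lia.
  have := grid_left rn (Ordinal n0) => /= ->.
  by apply/existsP => -[p]; lia.
- have n0 : 0 < n by lia.
  by have := grid_top n0 (Ordinal cn) => /= ->.
- have n0 : n.-1 < n by lia.
  have := grid_right rn (Ordinal n0) => /= ->; apply/existsP; exists (Ordinal rn).
  by rewrite entry_eq //=; have := ltn_ord (U r.+1 (Ordinal rn)); lia.
Qed.

Lemma grid_flow : 0 < n -> flow (tileAt (grid_of U)) n U.
Proof.
move=> n0; split=> [m i mn im|m]; first exact: grid_run.
rewrite leq_eqVlt => /orP[/eqP->|mn]; last exact: row_desc_top (R mn).
by have := row_desc_bot (R (m := n.-1) ltac:(lia)); rewrite prednK.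
Qed.

End GridOf.

(** * The bijection and the weights *)

Section BPD.
Variables (n : nat).
Hypothesis n0 : 0 < n.
Implicit Types (w : 'S_n) (D : grid n) (U : nat -> 'S_n).

Lemma BPD_flow w D : is_BPD w D -> exists U, 
  [/\ matching n (tileAt D), flow (tileAt D) n U, U n = w &
      forall m, m < n -> row_step m (U m.+1) (U m)].
Proof.
case=> -[M cr] aw; have [U F] := flow_exists n0 M; exists U; split=> //.
  exact: assoc_uniq (flow_assoc F (leqnn n)) aw.
by move=> m mn; apply: (row_of_flow F cr mn).
Qed.

Lemma grid_BPD U w : (forall m, m < n -> row_step m (U m.+1) (U m)) -> U n = w ->
  is_BPD w (grid_of U).
Proof.
move=> R Uw; have F := grid_flow R n0; split; last by rewrite -Uw; apply: flow_assoc.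
split; [exact: grid_matching R|exact: crossings_le1 F R].
Qed.

Lemma chain_flow D U : flow (tileAt D) n U ->
  chain_BPD D = [seq U (n.-1 - s) | s <- iota 0 n].
Proof. by move=> F; apply/eq_map => s; rewrite (flow_u_k F) //; lia. Qed.

Lemma nth_chain_flow D U s : flow (tileAt D) n U -> s < n ->
  nth 1%g (chain_BPD D) s = U (n.-1 - s).
Proof. by move=> F sn; rewrite (chain_flow F) (nth_map 0) ?size_iota // nth_iota. Qed.

Lemma chain_flow_inj D1 D2 U1 U2 : flow (tileAt D1) n U1 -> flow (tileAt D2) n U2 ->
  chain_BPD D1 = chain_BPD D2 -> forall k, k < n -> U1 k = U2 k.
Proof.
move=> F1 F2 e k kn; have h : n.-1 - k < n by lia.
by have := nth_chain_flow F1 h; rewrite e (nth_chain_flow F2 h) subKn //; lia.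
Qed.

Lemma flow_tiles_eq D1 D2 U1 U2 :
  matching n (tileAt D1) -> matching n (tileAt D2) ->
  flow (tileAt D1) n U1 -> flow (tileAt D2) n U2 ->
  (forall k, k <= n -> U1 k = U2 k) -> D1 = D2.
Proof.
move=> M1 M2 F1 F2 e; apply/ffunP => -[r c]; rewrite -!tileAtE.
have rn := ltn_ord r.
have [T1 B1] := flow_occupied M1 F1 c rn; have [T2 B2] := flow_occupied M2 F2 c rn.
apply: tile_ext.
- by rewrite T1 T2 e // ltnW.
- by rewrite B1 B2 e.
- by rewrite (flow_right M1 F1 _ rn) (flow_right M2 F2 _ rn) !e // ltnW.
Qed.

Lemma card_gt_ord m : #|[set i : 'I_n | m < i]| = n - m.+1.
Proof.
have -> : [set i : 'I_n | m < i] = ~: [set i : 'I_n | i < m.+1] by apply/setP => i; rewrite !inE -leqNgt.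
rewrite cardsCs setCK card_ord; case: (leqP m.+1 n) => mn.
  have inj : injective (widen_ord mn) by move=> i j /(congr1 val) e; apply: val_inj.
  congr (_ - _); rewrite -[RHS]card_ord -(card_imset _ inj).
  apply: eq_card => i; rewrite inE; apply/idP/imsetP => [im|[j _ ->]]; last exact: ltn_ord j.
  by exists (Ordinal im) => //; apply: val_inj.
have -> : [set i : 'I_n | i < m.+1] = setT.
  by apply/setP => i; rewrite !inE; have := ltn_ord i; lia.
by rewrite cardsT card_ord; lia.
Qed.

(** The set [S] of columns held beyond [m] above the row has [n - m.+1] elements. No pipe enters
    these from the top, so each is blank or has a right edge, and the latter are the moved ones. *)
Lemma blanks_moved D U m : matching n (tileAt D) -> flow (tileAt D) n U ->
  row_step m (U m.+1) (U m) -> m < n ->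
  #|moved m (U m.+1) (U m)| + blanks D m = n - m.+1.
Proof.
move=> M F R mn; pose S := U m @: [set i : 'I_n | m < i].
have -> : n - m.+1 = #|S| by rewrite card_imset ?card_gt_ord //; apply: perm_inj.
have SE c : (c \in S) = (m < (U m)^-1%g c).
  apply/imsetP/idP => [[x + ->]|mc]; first by rewrite inE permK.
  by exists ((U m)^-1%g c); rewrite ?inE ?permKV.
rewrite -(cardsID (moved m (U m.+1) (U m)) S).
congr (_ + _).
  by apply: eq_card => c; rewrite in_setI SE andb_idl // => /movedP[].
apply: eq_card => c; rewrite in_setD SE !inE.
have [hT hB] := flow_occupied M F c mn; have hR := flow_right M F c mn.
have Bl t : (t == Blank) = ~~ hasT t && ~~ hasR t by case: t.
rewrite Bl hT hR -leqNgt.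
(* In the equality case [c] is the value of [U m] at [m], outside [S]; it is not blank, since pipe
   [m] uses its right edge. *)
case: (ltngtP m ((U m)^-1%g c)) => //= mc; last first.
  apply/negbTE; rewrite negbK; apply/existsP; exists (Ordinal mn).
  rewrite entry_eq //= leqnn ltn_ord andbT.
  have /= := row_le R (q := Ordinal mn) (leqnn m).
  suff -> : U m (Ordinal mn) = c by [].
  by rewrite (_ : Ordinal mn = (U m)^-1%g c) ?permKV //; apply: val_inj.
rewrite andbT; congr (~~ _); apply: eq_existsb => p; case: (leqP p m) => //= pm.
congr (_ && _).
have vpc : U m p <> c :> nat by move=> /val_inj e; move: mc; rewrite -e permK; lia.
(* [entry] and [U m] differ only at [m], where both bounds on [c] hold: [c < n] trivially, the other
   by the descents of [U m]. *)
case: (nat_of_ord p =P m) => e; last by rewrite entry_ne.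
rewrite entry_eq // ltn_ord.
have ec : U m ((U m)^-1%g c) = c by rewrite permKV.
by have := row_desc_top R (i := p) (j := (U m)^-1%g c); rewrite e leqnn mc ec => /(_ isT isT).
Qed.

Lemma nth_down_seq s : s < n.-1 -> nth 0 (down_seq n) s = n.-1 - s.
Proof. by move=> sn; rewrite (nth_map 0) ?size_iota // nth_iota. Qed.

Lemma BPD_chain w D U : flow (tileAt D) n U -> U n = w ->
  (forall m, m < n -> row_step m (U m.+1) (U m)) ->
  chain_from_to (chain_BPD D) (down_seq n) w (w0 n).
Proof.
move=> F Uw R; have sz : size (chain_BPD D) = n by rewrite size_map size_iota.
have szd : size (down_seq n) = n.-1 by rewrite size_map size_iota.
split; first split; first by rewrite sz szd prednK.
- move=> s; rewrite szd => sn.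
  rewrite !(nth_chain_flow F); try lia.
  rewrite nth_down_seq //.
  (* Step [s] of the chain passes upwards through row [m]. *)
  pose m := n.-1 - s.+1; have em : n.-1 - s = m.+1 by lia.
  rewrite em -/m; apply: (kpath_inc_kchain (lo := 0) n0).
  by apply: row_kpath => //; apply: R; lia.
- rewrite (nth_chain_flow F) // subn0 -Uw.
  have := R n.-1 ltac:(lia); rewrite prednK // => /row_last -> //.
  by rewrite prednK.
- rewrite -nth_last sz (nth_chain_flow F) ?subnn; last lia.
  by apply: (@desc_uniq _ 0) => //; [apply: (flow_desc F)|apply: desc_w0].
Qed.

Lemma chain_BPD_onto w C : chain_from_to C (down_seq n) w (w0 n) ->
  exists D, is_BPD w D /\ chain_BPD D = C.
Proof.
case=> -[sz steps] C0 Cl.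
have szd : size (down_seq n) = n.-1 by rewrite size_map size_iota.
rewrite szd prednK // in sz steps.
(* Both [U n] and [U n.-1] are [w], because the last row contributes no step to the chain. *)
pose U k := if k == n then w else nth 1%g C (n.-1 - k).
have U0 : U 0 = w0 n by rewrite /U ifN_eqC -?lt0n // -Cl -nth_last sz subn0.
(* [kpath_row] needs the descents of the upper permutation and yields those of the lower one, so
   [dU] propagates them from [w0] downwards. *)
have R m : m < n -> desc m (U m) -> row_step m (U m.+1) (U m).
  move=> mn dm; case: (m.+1 =P n) => e.
    have -> : U m.+1 = U m.
      by rewrite /U e eqxx ifN ?ltn_eqF // -C0; congr nth; lia.
    exact: row_refl.
  have := steps (n.-1 - m.+1) ltac:(lia).
  rewrite nth_down_seq; last lia.
  rewrite subKn; last lia.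
  rewrite (_ : (n.-1 - m.+1).+1 = n.-1 - m); last lia.
  have -> : nth 1%g C (n.-1 - m.+1) = U m.+1 by rewrite /U ifN //; lia.
  have -> : nth 1%g C (n.-1 - m) = U m by rewrite /U ifN //; lia.
  by case/inc_kchain_kpath => d /(kpath_row dm)[].
have dU m : m <= n -> desc m (U m).
  elim: m => [|m IH] mn; first by rewrite U0; apply: desc_w0.
  by apply: row_desc_bot (R m mn (IH (ltnW mn))).
have {}R m : m < n -> row_step m (U m.+1) (U m) by move=> mn; apply: R => //; apply/dU/ltnW.
have Un : U n = w by rewrite /U eqxx.
exists (grid_of U); split; first exact: grid_BPD.
have F := grid_flow R n0.
apply: (@eq_from_nth _ 1%g) => [|s]; rewrite size_map size_iota ?sz // => sn.
rewrite (nth_chain_flow F sn) /U ifN ?subKn //; lia.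
Qed.

Lemma wt_chain_BPD D U : matching n (tileAt D) -> flow (tileAt D) n U ->
  (forall m, m < n -> row_step m (U m.+1) (U m)) ->
  wt_chain (chain_BPD D) =
  rev [seq ((p.1)%:Z - (p.2)%:Z)%R | p <- zip (down_seq n) (wt_BPD D)].
Proof.
move=> M F R; have sz : size (chain_BPD D) = n by rewrite size_map size_iota.
have szz : size (zip (down_seq n) (wt_BPD D)) = n.-1.
  by rewrite size_zip !size_map !size_iota minnn.
apply: (@eq_from_nth _ 0%R); first by rewrite /wt_chain size_map size_iota sz size_rev size_map szz.
move=> s; rewrite /wt_chain size_map size_iota sz => sn.
rewrite nth_rev size_map szz //.
rewrite !(nth_map (0, 0)) ?szz; try lia.
rewrite (nth_map 0) ?size_iota ?sz // nth_iota // add0n.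
rewrite nth_zip ?size_map ?size_iota //= nth_down_seq; last lia.
rewrite [nth 0 (wt_BPD D) _](nth_map 0) ?size_iota ?nth_iota; try lia.
rewrite !(nth_chain_flow F); try lia.
(* The reversal pairs step [s] with row [m], whose entry in [down_seq] is [s.+1 = n - m.+1]. The
   length difference is the size of [moved], and [blanks_moved] compares the two. *)
pose m := n.-1 - s.+1; have em : n.-1 - s = m.+1 by lia.
have mn : m < n by lia.
have es : n.-1 - (n.-1 - s.+1) = s.+1 by lia.
rewrite em es -/m add0n.
have Rm := R m mn.
have := kpath_len (row_kpath Rm (lo := 0) (fun _ _ _ => leq0n _)).
have := blanks_moved M F Rm mn; lia.
Qed.

End BPD.

Theorem theorem3p6 (n : nat) (w : 'S_n) : 1 <= n ->
  [/\ (forall D : grid n, is_BPD w D ->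
         chain_from_to (chain_BPD D) (down_seq n) w (w0 n)),
      (forall D1 D2 : grid n, is_BPD w D1 -> is_BPD w D2 ->
         chain_BPD D1 = chain_BPD D2 -> D1 = D2),
      (forall C : seq 'S_n, chain_from_to C (down_seq n) w (w0 n) ->
         exists D : grid n, is_BPD w D /\ chain_BPD D = C) &
      (forall D : grid n, is_BPD w D ->
         wt_chain (chain_BPD D) =
         rev [seq ((p.1)%:Z - (p.2)%:Z)%R | p <- zip (down_seq n) (wt_BPD D)])].
Proof.
move=> n0; split.
- by move=> D /(BPD_flow n0)[U [M F Uw R]]; apply: BPD_chain F Uw R.
- move=> D1 D2 /(BPD_flow n0)[U1 [M1 F1 Uw1 _]] /(BPD_flow n0)[U2 [M2 F2 Uw2 _]] e.
  apply: (flow_tiles_eq M1 M2 F1 F2) => k; rewrite leq_eqVlt => /orP[/eqP->|kn].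
    by rewrite Uw1 Uw2.
  exact: (chain_flow_inj n0 F1 F2 e).
- by move=> C; apply: chain_BPD_onto.
- by move=> D /(BPD_flow n0)[U [M F _ R]]; apply: wt_chain_BPD M F R.
Qed.
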